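(* Let $\xi\in\mathbb{R}$ be such that $1,\xi,\xi^3$ are linearly independent over $\mathbb{Q}$. Then $$\lambda(1,\xi,\xi^3)\le \mu:=\frac{2(9+\sqrt{11})}{35}\cong 0.7038 .$$
   Context: Let $n\ge 1$ be an integer and $\Xi=(\xi_0,\dots,\xi_n)\in\mathbb{R}^{n+1}$ with $\xi_0\ne 0$. A real number $\lambda\ge 0$ is a uniform exponent of approximation to $\Xi$ (by rational numbers) if there exists a constant $c=c(\Xi)>0$ such that, for each real number $X\ge 1$, the system $$|x_0|\le X \quad\text{and}\quad \max_{1\le i\le n}|x_0\xi_i-x_i\xi_0|\le cX^{-\lambda}$$ admits a non-zero solution $(x_0,\dots,x_n)\in\mathbb{Z}^{n+1}$. Then $\lambda(\Xi)$ denotes the supremum of these exponents $\lambda$. Here it is applied with $n=2$ and $\Xi=(1,\xi,\xi^3)$. *)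

(* Defs.v *)
From HB Require Import structures.
From mathcomp Require Import all_boot all_order all_algebra.
From mathcomp Require Import all_classical all_reals all_analysis.

Set Implicit Arguments.
Unset Strict Implicit.
Unset Printing Implicit Defensive.

Import Order.TTheory GRing.Theory Num.Theory.

Local Open Scope classical_set_scope.
Local Open Scope ring_scope.

Definition lin_indep_rat (R : realType) (m : nat) (v : 'rV[R]_m) : Prop :=
  forall q : 'I_m -> rat,
    \sum_(i < m) ratr (q i) * v ord0 i = 0 -> forall i : 'I_m, q i = 0.

(* max_(1 <= i <= n) |x_0 xi_i - x_i xi_0|.  The terms are nonnegative, so for
   n >= 1 starting the iterated maximum from 0 does not change its value. *)
Definition approx_error (R : realType) (n : nat)
    (Xi : 'rV[R]_n.+1) (x : 'rV[int]_n.+1) : R :=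
  \big[Num.max/0]_(i < n)
    `|(x ord0 ord0)%:~R * Xi ord0 (lift ord0 i)
      - (x ord0 (lift ord0 i))%:~R * Xi ord0 ord0|.

(* Meant for n >= 1 and Xi ord0 ord0 != 0. *)
Definition uniform_exponent (R : realType) (n : nat) (Xi : 'rV[R]_n.+1)
    (lambda : R) : Prop :=
  0 <= lambda /\
  exists2 c : R, 0 < c &
    forall X : R, 1 <= X ->
      exists x : 'rV[int]_n.+1,
        [/\ x != 0,
            `|(x ord0 ord0)%:~R| <= X
          & approx_error Xi x <= c * X `^ (- lambda)].

(* The supremum is taken in the extended reals because the set of exponents is
   unbounded when Xi is proportional to a rational point; in [R], [sup] would
   then return the default value 0. *)
Definition lambda_hat (R : realType) (n : nat) (Xi : 'rV[R]_n.+1) : \bar R :=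
  ereal_sup [set lambda%:E | lambda in uniform_exponent Xi].

Definition point_cube (R : realType) (xi : R) : 'rV[R]_3 :=
  \row_(i < 3) [:: 1; xi; xi ^+ 3]`_i.

(* Main.v *)
Require Import Defs.
From mathcomp Require Import all_boot all_order all_algebra.
From mathcomp Require Import ring lra zify.

(** Write Xi = (1, xi, xi^3), and suppose that an exponent lam is larger than
    mu = 2 (9 + sqrt 11) / 35, the larger root of 35 t^2 - 36 t + 8.  For an
    integer point p = (x0, x1, x2), call |x0| its height and the larger of
    |x1 - x0 xi| and |x2 - x0 xi^3| its error.

    The point Xi lies on the cubic curve phi = x0^2 x2 - x1^3 = 0.  So phi p is
    an integer which is small when p is close to the line through Xi: it is
    O(P^2 L) for a point of height P and error L.  Integrality then gives lower
    bounds as soon as phi p <> 0, and phi p <> 0 for the best approximations of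
    large height, because a point with phi p = 0 has coordinates with common
    factors ([phi0_param]) that make it a poor approximation ([phi_neq0]).

    Let x_0, x_1, ... be the successive best approximations.  Two consecutive
    ones form a basis of the integer points of their plane ([minpt_basis]).
    Starting from p = x_i and q = x_(i+1), follow the sequence as long as it
    stays in the plane of p and q; let r = n p + m q be the last point of the
    sequence there.  Both the height of r and a determinant control m
    ([stage_step]).  Then r and its successor start the next such step.

    The proof compares |m| with integers that m must divide to a high power.
    Let psi p r be the derivative of phi at p in the direction r, and put
    A = phi p, B = psi p r, F = B^2 - 4 A psi r p, K = A^2 phi r.  The binary
    cubic A^2 phi (X p + Y q) is the product of the conjugates of A X + theta Y
    for a cubic integer theta, and so A^2 phi (X p + Y r) is the product of the
    conjugates of A X + (N + m theta) Y, with N = n A.  Thus B and K are the trace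
    and the norm of N + m theta, and F is the square of the trace minus four times
    the second symmetric function.  The three conjugates of N + m theta agree
    modulo m.  Expressions in B, F, K that vanish when the
    conjugates coincide are therefore divisible by powers of m; the ones used
    are F^3 + 27 K^2 by m^2, U = F^3 - 18 K B F - 135 K^2 by m^3,
    S = F^2 - 3 K B by m^2, hence U^2 - S^3 by m^6.  In that last difference the
    leading terms F^6 cancel.  Since Xi lies on the curve, F is much
    smaller than B^2.  Whenever these integers do not vanish one gets upper
    bounds for |m| ([stage_quadratic], [stage_cubic_sextic]).  If F = 0 or
    F^3 + 27 K^2 = 0, the polar point B p - 2 A r differs from an integer
    multiple of p by a vector whose triple is divisible by m, and this quotient
    is a nonzero integer point, too small to exist unless the heights grow
    slowly ([stage_vector], [stage_disc0]).

    Passing to logarithms, a step turns into a system of linear inequalities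
    ([link], [degenerate], [generic], [stage_log]).  Rough consequences, true as
    soon as lam >= 19/27, exclude all cases but the sextic bound from some step
    on.  With a and b the logarithms of the heights of p and q, that bound
    makes a / b decrease at each step by a fixed amount proportional to
    35 lam^2 - 36 lam + 8 ([normalized_descent], [ratio_descent]), which cannot
    continue because a / b >= 0 ([no_chain]). *)

Set Implicit Arguments.
Unset Strict Implicit.
Unset Printing Implicit Defensive.
Import Order.TTheory GRing.Theory Num.Theory.
Local Open Scope ring_scope.

(** * Divisibility by powers of the index *)

Lemma norm_int_ge1 (R : numDomainType) (z : int) : z != 0 -> 1 <= `|z%:~R : R|.
Proof. by move=> z0; rewrite -intr_norm ler1z -gtz0_ge1 normr_gt0. Qed.

Lemma dvdz_norm_le (R : numDomainType) (d x : int) : x != 0 -> (d %| x)%Z ->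
  `|d%:~R| <= `|x%:~R : R|.
Proof.
move=> x0 dx; rewrite -!intr_norm ler_int.
by rewrite -!abszE lez_nat dvdn_leq // absz_gt0.
Qed.

(** The quotient [y / m] is a root of a monic quartic with integer coefficients,
    and a rational number that is integral over the integers is an integer. *)
Lemma dvdz_monic_quartic (y m a b c e : int) :
  y ^+ 4 = m * (a * y ^+ 3 + b * m * y ^+ 2 + c * m ^+ 2 * y + e * m ^+ 3) ->
  (m %| y)%Z.
Proof.
move=> h; have [m0|m0] := eqVneq m 0.
  move: h; rewrite m0 mul0r => /eqP; rewrite expf_eq0 /= => /eqP ->.
  by rewrite dvdz0.
have [u [v huv]] := Bezoutz y m.
have g0 : gcdz y m != 0 by rewrite gcdz_eq0 (negPf m0) andbF.
have /dvdzP[y' hy] := dvdz_gcdl y m; have /dvdzP[m' hm] := dvdz_gcdr y m.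
move: (gcdz y m) g0 huv hy hm => g g0 huv hy hm.
have cop : coprimez m' y'.
  apply/coprimezP; exists (v, u) => /=.
  by apply: (mulIf g0); rewrite mul1r -[RHS]huv hy hm; ring.
have h4 : y' ^+ 4 = m' * (a * y' ^+ 3 + b * m' * y' ^+ 2 + c * m' ^+ 2 * y'
                          + e * m' ^+ 3).
  apply: (mulIf (expf_neq0 4 g0)).
  transitivity (y ^+ 4); first by rewrite hy; ring.
  by rewrite h hm hy; ring.
have : (m' %| y' ^+ 4 * 1)%Z by rewrite mulr1 h4 dvdz_mulr.
rewrite Gauss_dvdzr ?coprimezXr // => /dvdzP[w hw].
apply/dvdzP; exists (y' * w).
by rewrite hy hm -[y' in LHS]mulr1 hw; ring.
Qed.

(** Let [theta] run over the roots of the cubic with elementary symmetric functions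
    [b], [c], [e].  Then [B] and [K] are the trace and the norm of
    [N + m theta], and [F] is the square of the trace minus four times the
    second symmetric function.  The polynomials [B F + 9 K] and
    [F^2 - 3 K B] and their first derivatives vanish at a triple of
    equal numbers, so their values at the three conjugates, which agree modulo
    [m], are divisible by [m^2].  The cofactors involve the coefficients [h0], [h1],
    [h2] of the Hessian of the cubic. *)
Section MonicCubic.
Variables m N b c e : int.
Let B := m * b + 3 * N.
Let F := m ^+ 2 * (b ^+ 2 - 4 * c) - 2 * m * N * b - 3 * N ^+ 2.
Let K := N ^+ 3 + m * b * N ^+ 2 + m ^+ 2 * c * N + m ^+ 3 * e.
Let h0 := b ^+ 2 - 3 * c.
Let h1 := b * c - 9 * e.
Let h2 := c ^+ 2 - 3 * b * e.
Let g := (m * b + N) * h0 - m * h1.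
Let s := h2 * m ^+ 2 + h1 * m * N + h0 * N ^+ 2 + 2 * h0 * F - (m * h0) ^+ 2.

Let hG : B * F + 9 * K = m ^+ 2 * g.
Proof. rewrite /B /F /K /g /h0 /h1; ring. Qed.

Let hS : F ^+ 2 - 3 * K * B = m ^+ 2 * s.
Proof. rewrite /s /B /F /K /h0 /h1 /h2; ring. Qed.

Lemma dvdz_quadratic_relation : (m ^+ 2 %| F ^+ 3 + 27 * K ^+ 2)%Z.
Proof.
apply/dvdzP; exists (F * s + 3 * K * g).
transitivity (F * (F ^+ 2 - 3 * K * B) + 3 * K * (B * F + 9 * K)); first by ring.
rewrite hG hS; ring.
Qed.

Lemma dvdz_square_relation : (m ^+ 2 %| F ^+ 2 - 3 * K * B)%Z.
Proof. by rewrite hS dvdz_mulr. Qed.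

(** The relation is [F (F^2 - 3 K B) - 15 K (B F + 9 K)], hence divisible by
    [m^2] with cofactor [F s - 15 K g].  Modulo [m] one has
    [F = - 3 N^2], [K = N^3], [s = - 5 h0 N^2] and [g = h0 N], so this cofactor
    vanishes modulo [m]. *)
Lemma dvdz_cubic_relation : (m ^+ 3 %| F ^+ 3 - 18 * K * B * F - 135 * K ^+ 2)%Z.
Proof.
have -> : F ^+ 3 - 18 * K * B * F - 135 * K ^+ 2 = m ^+ 2 * (F * s - 15 * K * g).
  transitivity (F * (F ^+ 2 - 3 * K * B) - 15 * K * (B * F + 9 * K)); first by ring.
  rewrite hG hS; ring.
have -> : m ^+ 3 = m ^+ 2 * m by ring.
apply: dvdz_mul => //; apply/dvdzP.
exists ((m * (b ^+ 2 - 4 * c) - 2 * N * b) * s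
  - 3 * N ^+ 2 * (h2 * m + h1 * N + 2 * h0 * (m * (b ^+ 2 - 4 * c) - 2 * N * b) - m * h0 ^+ 2)
   - 15 * (b * N ^+ 2 + m * c * N + m ^+ 2 * e) * g - 15 * N ^+ 3 * (b * h0 - h1)).
rewrite /g /s /K /F /h0 /h1 /h2; ring.
Qed.

(** When [F = 0], the number [3 N / m] satisfies a monic quadratic equation; it is
    multiplied by [(3 N / m)^2] to become a quartic. *)
Lemma dvdz_disc_eq0 : F = 0 -> (m %| 3 * N)%Z.
Proof.
move=> F0; apply: (@dvdz_monic_quartic _ _ (- 2 * b) (3 * (b ^+ 2 - 4 * c)) 0 0).
transitivity ((3 * N) ^+ 2 * (m * (3 * m * (b ^+ 2 - 4 * c) - 6 * N * b) - 3 * F));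
  [rewrite /F|rewrite F0]; ring.
Qed.

(** The two hypotheses say that [N] is a common root of a linear and a quadratic
    polynomial with coefficients depending on [k - N].  Their resultant is a
    quartic equation for [3 (k - N) / m], which turns out to be monic and
    integral. *)
Lemma dvdz_disc_square (k : int) :
  F = - (3 * k ^+ 2) -> K = k ^+ 3 -> (m %| 3 * (k - N))%Z.
Proof.
move=> hF hK; set d := k - N; have hk : k = N + d by rewrite /d addrC subrK.
have r1 : 2 * N * (m * b - 3 * d) - (m ^+ 2 * (b ^+ 2 - 4 * c) + 3 * d ^+ 2) = 0.
  transitivity (- (3 * k ^+ 2) - F); last by rewrite hF subrr.
  rewrite /F hk; ring.
have r2 : N ^+ 2 * (3 * d - m * b) + N * (3 * d ^+ 2 - m ^+ 2 * c)
          + d ^+ 3 - m ^+ 3 * e = 0.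
  transitivity (k ^+ 3 - K); last by rewrite hK subrr.
  rewrite /K hk; ring.
(* The coefficients are those of the resultant. *)
apply: (@dvdz_monic_quartic _ _ (4 * b) (- 18 * c) (108 * e)
   (27 * ((b ^+ 2 - 4 * c) * (2 * c - b ^+ 2) - 4 * e * b))).
apply/eqP; rewrite -subr_eq0; apply/eqP.
move: r1 r2; set R1 := (X in X = 0) => r1; set R2 := (X in X = 0) => r2.
transitivity (- 27 * (2 * (m * b - 3 * d) * (2 * R2 + N * R1)
   - R1 * (3 * d ^+ 2 - 2 * m ^+ 2 * c - m ^+ 2 * (b ^+ 2 - 4 * c)))).
  rewrite /R1 /R2; ring.
rewrite r1 r2; ring.
Qed.
End MonicCubic.

(** The integer [k] is [K / w]. *)
Lemma cube_eq_square (w K : int) : K != 0 -> w ^+ 3 = K ^+ 2 ->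
  exists k, w = k ^+ 2 /\ K = k ^+ 3.
Proof.
move=> K0 h; have w0 : w != 0.
  apply: contra_neq K0 => w0; apply/eqP.
  by move: h; rewrite w0 expr0n => /esym/eqP; rewrite expf_eq0.
have /dvdzP[k hk] : (w %| K)%Z.
  by rewrite -(@dvdz_pexp2r _ _ 2) // -h exprS dvdz_mull.
have hw : w = k ^+ 2.
  by apply: (mulIf (expf_neq0 2 w0)); rewrite -exprS h hk exprMn.
by exists k; split=> //; rewrite hk hw; ring.
Qed.

(** * Sizes of the divisible integers *)

(** Below the threshold [17 |K B|] for [F^2], the term [18 K B F] dominates the
    two others. *)
Lemma cubic_relation_size (R : realFieldType) (K B F : R) :
  1 <= `|K| -> 1 <= `|F| -> 1000 * `|K| <= `|B| ->
  F ^+ 2 <= 17 * `|K * B| ->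
  let U := F ^+ 3 - 18 * K * B * F - 135 * K ^+ 2 in
  U != 0 /\ `|U| <= 36 * `|K * B * F|.
Proof.
move=> k1 f1 hKB + U.
have ht : 1000 * K ^+ 2 <= `|K * B|.
  rewrite -[K ^+ 2]real_normK ?num_real // expr2 mulrA normrM [leRHS]mulrC.
  by rewrite ler_wpM2r.
have K2 : 1 <= K ^+ 2 by rewrite -[K ^+ 2]real_normK ?num_real // exprn_ege1.
have eU : U = F * (F ^+ 2 - 18 * (K * B)) - 135 * K ^+ 2 by rewrite /U; ring.
rewrite eU; move: (K * B) ht => t {eU} htt; clear U => hF.
have htF : `|t| <= `|t * F| by rewrite normrM ler_peMr.
have F2 : 0 <= F ^+ 2 by exact: sqr_ge0.
have [hge hle] : `|t| <= `|F ^+ 2 - 18 * t| /\ `|F ^+ 2 - 18 * t| <= 35 * `|t|.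
  move: hF; case: (ler0P t) => ht0 hF.
    by rewrite ger0_norm; [split|]; lra.
  by rewrite ler0_norm; [split|]; lra.
have p1 : `|t * F| <= `|F * (F ^+ 2 - 18 * t)| by rewrite !normrM mulrC ler_wpM2l.
have p2 : `|F * (F ^+ 2 - 18 * t)| <= 35 * `|t * F|.
  by rewrite !normrM [`|t| * _]mulrC mulrCA ler_wpM2l.
move: p1 p2; set p := F * _; move=> p1 p2.
split.
  apply: contraTneq p1 => /eqP; rewrite subr_eq0 => /eqP ->.
  by rewrite -ltNge ger0_norm; lra.
apply: (le_trans (ler_normB _ _)); rewrite [`|135 * _|]ger0_norm; lra.
Qed.

(** The terms [F^6] of [U^2] and [S^3] cancel and, above the threshold for
    [F^2], the dominant remaining term is [- 27 K B F^4].  The gain over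
    [F^6] is what makes the final inequality sharp. *)
Lemma sextic_relation_size (R : realFieldType) (K B F : R) :
  1 <= `|K| -> 1 <= `|F| -> 1000 * `|K| <= `|B| -> 17 * `|K * B| < F ^+ 2 ->
  let U := F ^+ 3 - 18 * K * B * F - 135 * K ^+ 2 in
  let S := F ^+ 2 - 3 * K * B in
  U ^+ 2 - S ^+ 3 != 0 /\ `|U ^+ 2 - S ^+ 3| <= 50 * (`|K * B| * F ^+ 4).
Proof.
move=> k1 f1 hKB + U S.
have ht : 1000 * K ^+ 2 <= `|K * B|.
  rewrite -[K ^+ 2]real_normK ?num_real // expr2 mulrA normrM [leRHS]mulrC.
  by rewrite ler_wpM2r.
have K2 : 1 <= K ^+ 2 by rewrite -[K ^+ 2]real_normK ?num_real // exprn_ege1.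
(* Each summand after the first is a small multiple of [X] below. *)
have -> : U ^+ 2 - S ^+ 3 = 27 * (- ((K * B) * F ^+ 4)
   + 11 * ((K * B) ^+ 2 * F ^+ 2) + (K * B) ^+ 3
   - 10 * (K ^+ 2 * F ^+ 3) + 180 * (K ^+ 2 * (K * B) * F) + 675 * K ^+ 4).
  rewrite /U /S; ring.
move: (K * B) ht => t htt; clear U S => hF.
have hf2 : F ^+ 2 = `|F| ^+ 2 by rewrite real_normK ?num_real.
have -> : F ^+ 4 = `|F| ^+ 4 by rewrite -[4%N]/(2 * 2)%N !exprM hf2.
move: hF hf2 f1; set a := `|t| in htt *; set f := `|F| => hF hf2 f1'.
rewrite hf2 in hF.
have a1 : 1 <= a by lra.
set X := a * f ^+ 4.
have K20 := sqr_ge0 K.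
have f34 : f ^+ 3 <= f ^+ 4 by rewrite ler_weXn2l.
have f12 : f <= f ^+ 2 by rewrite -{1}[f]expr1 ler_weXn2l.
have f24 : f ^+ 2 <= f ^+ 4 by rewrite ler_weXn2l.
have f0 : 0 < f by lra.
have f3 : 0 <= f ^+ 3 by exact: exprn_ge0 (ltW f0).
have X0 : 0 < X by apply: mulr_gt0; [lra|exact: exprn_gt0].
have ff : f ^+ 4 = f ^+ 2 * f ^+ 2 by ring.
have e0 : `|t * f ^+ 4| = X by rewrite normrM normrX normr_id.
have e1 : 17 * `|t ^+ 2 * F ^+ 2| <= X.
  rewrite normrM !normrX -/a -/f /X ff.
  have -> : 17 * (a ^+ 2 * f ^+ 2) = a * ((17 * a) * f ^+ 2) by ring.
  by rewrite ler_wpM2l ?normr_ge0 // ler_wpM2r ?exprn_ge0 // ltW.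
have e2 : 289 * `|t ^+ 3| <= X.
  rewrite normrX -/a /X ff.
  have -> : 289 * a ^+ 3 = a * ((17 * a) * (17 * a)) by ring.
  have h17a : 17 * a <= f ^+ 2 by exact: ltW.
  by rewrite ler_wpM2l ?normr_ge0 //; apply: ler_pM => //; rewrite mulr_ge0 ?normr_ge0.
have e3 : 1000 * `|K ^+ 2 * F ^+ 3| <= X.
  rewrite normrM (ger0_norm (sqr_ge0 K)) normrX -/f /X mulrA.
  by apply: ler_pM => //; rewrite mulr_ge0.
have h17 : 17000 * K ^+ 2 <= f ^+ 2 by clear -htt hF; lra.
have e4 : 17000 * `|K ^+ 2 * t * F| <= X.
  rewrite (normrM _ F) (normrM _ t) (ger0_norm (sqr_ge0 K)) -/a -/f /X ff.
  have -> : 17000 * (K ^+ 2 * a * f) = a * ((17000 * K ^+ 2) * f) by ring.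
  rewrite ler_wpM2l ?normr_ge0 //; apply: ler_pM => //; first by rewrite mulr_ge0.
  exact: ltW.
have e5 : 10000 * `|K ^+ 4| <= X.
  have -> : K ^+ 4 = K ^+ 2 * K ^+ 2 by ring.
  rewrite ger0_norm; last by apply: mulr_ge0; exact: sqr_ge0.
  have -> : 10000 * (K ^+ 2 * K ^+ 2) = (1000 * K ^+ 2) * (10 * K ^+ 2) by ring.
  have h10 : 10 * K ^+ 2 <= f ^+ 4 by clear -h17 f24 K20; lra.
  by rewrite /X; apply: ler_pM => //; rewrite mulr_ge0.
move: e0 e1 e2 e3 e4 e5 X0; rewrite -/X.
move: (t * f ^+ 4) (t ^+ 2 * F ^+ 2) (t ^+ 3) (K ^+ 2 * F ^+ 3) (K ^+ 2 * t * F) (K ^+ 4) X.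
clear=> t0 t1 t2 t3 t4 t5 X e0 e1 e2 e3 e4 e5 X0.
(* The five lower terms are together at most
   [(11 / 17 + 1 / 100 + 1 / 50 + 1 / 50 + 1 / 10) X < X] in absolute value. *)
have bnd (n c k : nat) (z : R) : n%:R * `|z| <= X -> (k * c <= n)%N ->
    - X <= k%:R * (c%:R * z) /\ k%:R * (c%:R * z) <= X.
  move=> hz kc; apply/andP; rewrite -ler_norml mulrA -natrM normrM normr_nat.
  by apply: le_trans hz; rewrite ler_wpM2r // ler_nat.
have := bnd 17 1 17 _ e1 isT; have := bnd 289 1 100 _ e2 isT.
have := bnd 1000 10 50 _ e3 isT; have := bnd 17000 180 50 _ e4 isT.
have := bnd 10000 675 10 _ e5 isT; clear e1 e2 e3 e4 e5 bnd; rewrite !mul1r.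
move: (10 * t3) (180 * t4) (675 * t5) => {t3 t4 t5} t3 t4 t5.
move=> [u5 v5] [u4 v4] [u3 v3] [u2 v2] [u1 v1].
have {e0} [e0|e0] : t0 = X \/ t0 = - X.
  by case: (ler0P t0) e0 => h <-; rewrite ?opprK; [right|left].
- by rewrite e0 ler_norml; split; [apply: ltr0_neq0|apply/andP; split]; lra.
- by rewrite e0 ler_norml; split; [apply: lt0r_neq0|apply/andP; split]; lra.
Qed.

(** * Bounds for expansions near the curve *)

Lemma le_norm_add (R : numDomainType) (x y a b : R) :
  `|x| <= a -> `|y| <= b -> `|x + y| <= a + b.
Proof. by move=> hx hy; apply: le_trans (ler_normD _ _) (lerD hx hy). Qed.

Lemma le_norm_opp (R : numDomainType) (x a : R) : `|x| <= a -> `|- x| <= a.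
Proof. by rewrite normrN. Qed.

Lemma le_norm_mul (R : numDomainType) (x y a b : R) :
  `|x| <= a -> `|y| <= b -> `|x * y| <= a * b.
Proof. by move=> hx hy; rewrite normrM; apply: ler_pM. Qed.

Lemma le_norm_exp (R : numDomainType) (x a : R) n : `|x| <= a -> `|x ^+ n| <= a ^+ n.
Proof. by move=> hx; rewrite normrX lerXn2r // nnegrE // (le_trans _ hx). Qed.

Lemma le_norm_nat (R : numDomainType) n : `|n%:R : R| <= n%:R.
Proof. by rewrite normr_nat. Qed.

(** Proves that a polynomial expression is bounded by the same expression in
    bounds for its atoms, by following the syntax of the expression. *)
Ltac norm_bound := solve [repeat first
  [ eassumption | exact: le_norm_nat | eapply le_norm_add | eapply le_norm_opp
  | eapply le_norm_mul | eapply le_norm_exp ]].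

(** In the coordinates [w = x0], [d = x1 - x0 xi] and
    [D = (x2 - x0 xi^3) - 3 xi^2 d], with [a = 3 xi], the form [phi] becomes
    [w^2 D - a w d^2 - d^3], without a term in [w^3] or in [w^2 d] because [D] is the
    linear form of the tangent at [Xi].  The bounds of this part are stated for these
    expressions in real variables; [x, d, D] and [y, e, D'] stand for the
    coordinates of two points, with heights [X], [Y] and errors [L], [L']. *)
Lemma phi_expansion_le (R : realFieldType) (w d D a W L Z : R) : 1 <= Z -> 0 <= W -> 0 <= L ->
  `|w| <= W -> `|d| <= L -> `|D| <= Z * L -> `|a| <= Z ->
  `|w ^+ 2 * D - a * w * d ^+ 2 - d ^+ 3| <= Z * ((W + L) ^+ 2 * L).
Proof.
move=> Z1 W0 L0 hw hd hD ha.
have Z0 : 0 <= Z by lra.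
apply: (@le_trans _ _ (W ^+ 2 * (Z * L) + Z * W * L ^+ 2 + L ^+ 3)); first by norm_bound.
have -> : Z * ((W + L) ^+ 2 * L) = W ^+ 2 * (Z * L) + Z * W * L ^+ 2 + L ^+ 3
   + (Z * W * L ^+ 2 + (Z - 1) * L ^+ 3) by ring.
by rewrite lerDl addr_ge0 ?mulr_ge0 ?exprn_ge0 // subr_ge0.
Qed.

Lemma psi_expansion_le (R : realFieldType) (x d D y e D' a X Y L L' Z : R) :
  1 <= Z -> 1 <= X -> X <= Y -> 0 <= L' -> L' <= L -> L <= 1 ->
  `|x| <= X -> `|y| <= Y -> `|d| <= L -> `|e| <= L' ->
  `|D| <= Z * L -> `|D'| <= Z * L' -> `|a| <= Z ->
  `|x ^+ 2 * D' + 2 * x * y * D - a * y * d ^+ 2 - 2 * a * x * d * e - 3 * d ^+ 2 * e|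
    <= 9 * Z * (X * Y * L).
Proof.
move=> Z1 X1 XY L'0 LL L1 hx hy hd he hD hD' ha.
have [Z0 X0 Y0 L0] : [/\ 0 <= Z, 0 <= X, 0 <= Y & 0 <= L] by split; lra.
apply: (@le_trans _ _ (X ^+ 2 * (Z * L') + 2 * X * Y * (Z * L) + Z * Y * L ^+ 2
   + 2 * Z * X * L * L' + 3 * L ^+ 2 * L')); first by norm_bound.
have XL : X * L' <= Y * L by apply: ler_pM.
have LX : L <= X by lra.
have m1 : X * (X * L') <= X * (Y * L) by apply: ler_wpM2l.
have m2 : (Y * L) * L <= (Y * L) * X by apply: ler_wpM2l; rewrite ?mulr_ge0.
have m3 : L * (X * L') <= X * (Y * L) by apply: ler_pM; rewrite ?mulr_ge0.
have m4 : L * (L * L') <= X * (Y * L).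
  by apply: ler_pM; rewrite ?mulr_ge0 //; apply: ler_pM => //; lra.
have n0 : 0 <= X * (Y * L) by rewrite !mulr_ge0.
have n1 := ler_wpM2l Z0 m1; have n2 := ler_wpM2l Z0 m2; have n3 := ler_wpM2l Z0 m3.
have n4 : 1 * (L * (L * L')) <= Z * (X * (Y * L)).
  by apply: ler_pM => //; rewrite !mulr_ge0.
lra.
Qed.

(** The terms [2 x^2 y D] of [psi p r * x] and [2 phi p * y] cancel, so that the first
    coordinate of the polar point is small. *)
Lemma polar_expansion_le (R : realFieldType) (x d D y e D' a X Y L L' Z : R) :
  1 <= Z -> 1 <= X -> X <= Y -> 0 <= L' -> L' <= L -> L <= 1 ->
  `|x| <= X -> `|y| <= Y -> `|d| <= L -> `|e| <= L' ->
  `|D| <= Z * L -> `|D'| <= Z * L' -> `|a| <= Z ->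
  `|(x ^+ 2 * D' + 2 * x * y * D - a * y * d ^+ 2 - 2 * a * x * d * e - 3 * d ^+ 2 * e) * x
    - 2 * (x ^+ 2 * D - a * x * d ^+ 2 - d ^+ 3) * y|
    <= 6 * Z * (X ^+ 3 * L' + X * Y * L ^+ 2).
Proof.
move=> Z1 X1 XY L'0 LL L1 hx hy hd he hD hD' ha.
have [Z0 X0 Y0 L0] : [/\ 0 <= Z, 0 <= X, 0 <= Y & 0 <= L] by split; lra.
rewrite [X in `|X|](_ : _ = x ^+ 3 * D' + a * x * y * d ^+ 2
   - 2 * a * x ^+ 2 * d * e - 3 * x * d ^+ 2 * e + 2 * y * d ^+ 3); last by ring.
apply: (@le_trans _ _ (X ^+ 3 * (Z * L') + Z * X * Y * L ^+ 2
   + 2 * Z * X ^+ 2 * L * L' + 3 * X * L ^+ 2 * L' + 2 * Y * L ^+ 3)); first by norm_bound.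
have LX : L <= X by lra.
set u := X ^+ 3 * L'; set v := X * Y * L ^+ 2.
have m1 : (X ^+ 2 * L') * L <= (X ^+ 2 * L') * X by apply: ler_wpM2l; rewrite ?mulr_ge0 ?exprn_ge0.
have m2 : (X * L') * (L * L) <= (X * L') * (X * X).
  by apply: ler_wpM2l; rewrite ?mulr_ge0 //; apply: ler_pM.
have m3 : (Y * L ^+ 2) * L <= (Y * L ^+ 2) * X by apply: ler_wpM2l; rewrite ?mulr_ge0 ?exprn_ge0.
have u0 : 0 <= u by rewrite /u !mulr_ge0 ?exprn_ge0.
have v0 : 0 <= v by rewrite /v !mulr_ge0 ?exprn_ge0.
have n1 := ler_wpM2l Z0 m1.
have n2 : 1 * (X * L' * (L * L)) <= Z * u.
  by apply: ler_pM => //; [rewrite !mulr_ge0|rewrite /u; lra].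
have n3 : 1 * (Y * L ^+ 2 * L) <= Z * v.
  by apply: ler_pM => //; [rewrite !mulr_ge0 ?exprn_ge0|rewrite /v; lra].
have Zu := mulr_ge0 Z0 u0; have Zv := mulr_ge0 Z0 v0.
move: n1 n2 n3 Zu Zv; rewrite /u /v; lra.
Qed.

(** The terms [4 x^2 y^2 D^2] cancel.  What remains are the terms of degree four in
    the errors of the first point, of size [Y^2 L^4], and products containing [L']. *)
Lemma disc_expansion_le (R : realFieldType) (x d D y e D' a X Y L L' Z : R) :
  1 <= Z -> 1 <= X -> X <= Y -> 0 <= L' -> L' <= L -> L <= 1 ->
  `|x| <= X -> `|y| <= Y -> `|d| <= L -> `|e| <= L' ->
  `|D| <= Z * L -> `|D'| <= Z * L' -> `|a| <= Z ->
  `|(x ^+ 2 * D' + 2 * x * y * D - a * y * d ^+ 2 - 2 * a * x * d * e - 3 * d ^+ 2 * e) ^+ 2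
    - 4 * (x ^+ 2 * D - a * x * d ^+ 2 - d ^+ 3)
      * (y ^+ 2 * D + 2 * x * y * D' - a * x * e ^+ 2 - 2 * a * y * d * e - 3 * e ^+ 2 * d)|
    <= 200 * Z ^+ 2 * (Y ^+ 2 * L ^+ 4 + X ^+ 3 * Y * L * L').
Proof.
move=> Z1 X1 XY L'0 LL L1 hx hy hd he hD hD' ha.
have [Z0 X0 Y0 L0] : [/\ 0 <= Z, 0 <= X, 0 <= Y & 0 <= L] by split; lra.
pose A1 := y * (2 * x * D - a * d ^+ 2).
pose B1 := x ^+ 2 * D' - 2 * a * x * d * e - 3 * d ^+ 2 * e.
pose C1 := 2 * x * y * D' - a * x * e ^+ 2 - 2 * a * y * d * e - 3 * e ^+ 2 * d.
pose P1 := x ^+ 2 * D - a * x * d ^+ 2 - d ^+ 3.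
rewrite [X in `|X|](_ : _ = y ^+ 2 * (a ^+ 2 * d ^+ 4 + 4 * d ^+ 3 * D)
   + 2 * A1 * B1 + B1 ^+ 2 - 4 * P1 * C1); last by rewrite /A1 /B1 /C1 /P1; ring.
have LX : L <= X by lra.
have L'1 : L' <= 1 by lra.
have XL : X * L' <= Y * L by apply: ler_pM.
have bA : `|A1| <= 3 * Z * (X * Y * L).
  apply: (@le_trans _ _ (Y * (2 * X * (Z * L) + Z * L ^+ 2))); first by rewrite /A1; norm_bound.
  have m : (Z * Y * L) * L <= (Z * Y * L) * X by apply: ler_wpM2l; rewrite ?mulr_ge0.
  lra.
have bB : `|B1| <= 6 * Z * (X ^+ 2 * L').
  apply: (@le_trans _ _ (X ^+ 2 * (Z * L') + 2 * Z * X * L * L' + 3 * L ^+ 2 * L')).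
    by rewrite /B1; norm_bound.
  have m : (Z * X * L') * L <= (Z * X * L') * X by apply: ler_wpM2l; rewrite ?mulr_ge0.
  have m' : (1 * L') * (L * L) <= (Z * L') * (X * X).
    by apply: ler_pM; rewrite ?mulr_ge0 //; [apply: ler_wpM2r|apply: ler_pM].
  lra.
have bC : `|C1| <= 8 * Z * (X * Y * L').
  apply: (@le_trans _ _ (2 * X * Y * (Z * L') + Z * X * L' ^+ 2 + 2 * Z * Y * L * L'
     + 3 * L' ^+ 2 * L)); first by rewrite /C1; norm_bound.
  have m1 : (Z * X * L') * L' <= (Z * X * L') * Y by apply: ler_wpM2l; rewrite ?mulr_ge0 //; lra.
  have m2 : (Z * Y * L') * L <= (Z * Y * L') * X by apply: ler_wpM2l; rewrite ?mulr_ge0.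
  have m3 : (1 * L') * (L' * L) <= (Z * L') * (Y * X).
    by apply: ler_pM; rewrite ?mulr_ge0 //; [apply: ler_wpM2r|apply: ler_pM => //; lra].
  lra.
have bP : `|P1| <= 3 * Z * (X ^+ 2 * L).
  apply: (@le_trans _ _ (X ^+ 2 * (Z * L) + Z * X * L ^+ 2 + L ^+ 3)); first by rewrite /P1; norm_bound.
  have m : (Z * X * L) * L <= (Z * X * L) * X by apply: ler_wpM2l; rewrite ?mulr_ge0.
  have m' : (1 * L) * (L * L) <= (Z * L) * (X * X).
    by apply: ler_pM; rewrite ?mulr_ge0 //; [apply: ler_wpM2r|apply: ler_pM].
  lra.
apply: (@le_trans _ _ (Y ^+ 2 * (Z ^+ 2 * L ^+ 4 + 4 * L ^+ 3 * (Z * L))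
  + 2 * (3 * Z * (X * Y * L)) * (6 * Z * (X ^+ 2 * L')) + (6 * Z * (X ^+ 2 * L')) ^+ 2
  + 4 * (3 * Z * (X ^+ 2 * L)) * (8 * Z * (X * Y * L')))).
  move: A1 B1 C1 P1 bA bB bC bP => A1 B1 C1 P1 bA bB bC bP; norm_bound.
have m1 : (Y ^+ 2 * L ^+ 4 * Z) * 1 <= (Y ^+ 2 * L ^+ 4 * Z) * Z.
  by apply: ler_wpM2l; rewrite ?mulr_ge0 ?exprn_ge0.
have m2 : (Z ^+ 2 * X ^+ 3 * L') * (X * L') <= (Z ^+ 2 * X ^+ 3 * L') * (Y * L).
  by apply: ler_wpM2l; rewrite ?mulr_ge0 ?exprn_ge0.
have p1 : 0 <= Z ^+ 2 * Y ^+ 2 * L ^+ 4 by rewrite !mulr_ge0 ?exprn_ge0.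
have p2 : 0 <= Z ^+ 2 * X ^+ 3 * Y * L * L' by rewrite !mulr_ge0 ?exprn_ge0.
lra.
Qed.

(** * The cubic form on a plane *)

Record zpoint := ZPoint { pt0 : int; pt1 : int; pt2 : int }.

Definition phi (p : zpoint) : int := pt0 p ^+ 2 * pt2 p - pt1 p ^+ 3.

(** The derivative of [phi] at [p] in the direction [q]. *)
Definition psi (p q : zpoint) : int :=
  pt0 p ^+ 2 * pt2 q + 2 * pt0 p * pt2 p * pt0 q - 3 * pt1 p ^+ 2 * pt1 q.

Definition comb (n m : int) (p q : zpoint) : zpoint :=
  ZPoint (n * pt0 p + m * pt0 q) (n * pt1 p + m * pt1 q) (n * pt2 p + m * pt2 q).

Definition det3 (p q r : zpoint) : int :=
  pt0 p * (pt1 q * pt2 r - pt2 q * pt1 r) - pt0 q * (pt1 p * pt2 r - pt2 p * pt1 r)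
  + pt0 r * (pt1 p * pt2 q - pt2 p * pt1 q).

(** Write [phi (X p + Y q) = A X^3 + B X^2 Y + C X Y^2 + E Y^3].  Its product
    with [A^2] is the product of [A X + theta Y] over three cubic integers [theta]
    with elementary symmetric functions [B], [A C] and [A^2 E].  Here [bnorm] is their
    norm, and [bdisc] is the square of their trace minus four times the second
    symmetric function. *)
Definition bdisc (p q : zpoint) : int := psi p q ^+ 2 - 4 * phi p * psi q p.
Definition bnorm (p q : zpoint) : int := phi p ^+ 2 * phi q.
(** When [p] and [q] are close to the line of [(1, xi, xi^3)], the leading terms
    of [psi p q] and [2 phi p] are proportional to the first coordinates of [q]
    and [p], which makes the first coordinate of this combination small. *)
Definition polar (p q : zpoint) : zpoint := comb (psi p q) (- 2 * phi p) p q.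

Lemma phi_comb n m p q : phi (comb n m p q) =
  n ^+ 3 * phi p + n ^+ 2 * m * psi p q + n * m ^+ 2 * psi q p + m ^+ 3 * phi q.
Proof. by rewrite /phi /psi /=; ring. Qed.

Lemma psi_comb n m p q : psi p (comb n m p q) = 3 * n * phi p + m * psi p q.
Proof. by rewrite /phi /psi /=; ring. Qed.

Lemma psi_combl n m p q : psi (comb n m p q) p =
  3 * n ^+ 2 * phi p + 2 * m * n * psi p q + m ^+ 2 * psi q p.
Proof. by rewrite /phi /psi /=; ring. Qed.

Lemma phi_polar p q :
  phi (polar p q) = - (phi p * (psi p q * bdisc p q + 8 * bnorm p q)).
Proof. by rewrite /polar phi_comb /bdisc /bnorm; ring. Qed.

(** The points [p] and [n p + m q] generate a sublattice of index [m].  Passing to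
    this sublattice replaces each factor [A X + theta Y] of [A^2 phi (X p + Y q)] by
    [A X + (n A + m theta) Y], whence the divisibilities. *)
Section Sublattice.
Variables (p q : zpoint) (n m : int).
Let r := comb n m p q.

Let BE : psi p r = m * psi p q + 3 * (n * phi p).
Proof. by rewrite psi_comb; ring. Qed.

Let FE : bdisc p r = m ^+ 2 * (psi p q ^+ 2 - 4 * (phi p * psi q p))
   - 2 * m * (n * phi p) * psi p q - 3 * (n * phi p) ^+ 2.
Proof. by rewrite /bdisc psi_comb psi_combl; ring. Qed.

Let KE : bnorm p r = (n * phi p) ^+ 3 + m * psi p q * (n * phi p) ^+ 2
  + m ^+ 2 * (phi p * psi q p) * (n * phi p) + m ^+ 3 * (phi p ^+ 2 * phi q).
Proof. by rewrite /bnorm phi_comb; ring. Qed.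

Lemma sublattice_quadratic : (m ^+ 2 %| bdisc p r ^+ 3 + 27 * bnorm p r ^+ 2)%Z.
Proof. rewrite FE KE; exact: dvdz_quadratic_relation. Qed.

Lemma sublattice_cubic :
  (m ^+ 3 %| bdisc p r ^+ 3 - 18 * bnorm p r * psi p r * bdisc p r
             - 135 * bnorm p r ^+ 2)%Z.
Proof. rewrite FE KE BE; exact: dvdz_cubic_relation. Qed.

Lemma sublattice_sextic :
  (m ^+ 6 %| (bdisc p r ^+ 3 - 18 * bnorm p r * psi p r * bdisc p r
             - 135 * bnorm p r ^+ 2) ^+ 2
      - (bdisc p r ^+ 2 - 3 * bnorm p r * psi p r) ^+ 3)%Z.
Proof.
apply: rpredB.
  by rewrite -[6%N]/(3 * 2)%N exprM; apply: dvdz_exp2r; exact: sublattice_cubic.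
rewrite -[6%N]/(2 * 3)%N exprM; apply: dvdz_exp2r.
rewrite FE KE BE; exact: dvdz_square_relation.
Qed.

(** If [m] divides [3 (k - n A)], it divides three times the coordinates of the polar
    point minus [k p]; the quotient is given in the basis [p], [q]. *)
Lemma polar_divisible (k t : int) : 3 * (k - n * phi p) = t * m ->
  let w := comb (3 * psi p q - t) (- 6 * phi p) p q in
  [/\ m * pt0 w = 3 * (pt0 (polar p r) - k * pt0 p),
      m * pt1 w = 3 * (pt1 (polar p r) - k * pt1 p) &
      m * pt2 w = 3 * (pt2 (polar p r) - k * pt2 p)].
Proof.
move=> h w.
have e (a b c : int) : c = n * a + m * b ->
   m * ((3 * psi p q - t) * a + (- 6 * phi p) * b)
   = 3 * (psi p r * a + (- 2 * phi p) * c - k * a).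
  move=> ->; rewrite BE.
  transitivity (m * (3 * psi p q * a - 6 * phi p * b) - (t * m) * a); first by ring.
  by rewrite -h; ring.
by rewrite /w /polar /=; split; apply: e.
Qed.

Lemma polar_divisible_disc0 : bdisc p r = 0 -> exists t, 3 * (0 - n * phi p) = t * m.
Proof.
rewrite FE => h; have /dvdzP[t ht] := dvdz_disc_eq0 h.
by exists (- t); rewrite mulNr -ht; ring.
Qed.

(** From [F^3 = - 27 K^2] follows that [- F / 3] is an integer whose cube is
    a square, so that [F] and [K] have the values that they take at three
    conjugates equal to [k]. *)
Lemma polar_divisible_quadratic0 : bnorm p r != 0 ->
  bdisc p r ^+ 3 + 27 * bnorm p r ^+ 2 = 0 ->
  exists k t, bdisc p r = - (3 * k ^+ 2) /\ 3 * (k - n * phi p) = t * m.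
Proof.
move=> K0 h.
have /dvdzP[f hf] : (3 %| bdisc p r)%Z.
  rewrite -(@dvdz_pexp2r _ _ 3) //; apply/dvdzP; exists (- bnorm p r ^+ 2).
  by apply/eqP; rewrite -subr_eq0 -h; apply/eqP; ring.
have [|k [h1 h2]] := @cube_eq_square (- f) _ K0.
  apply: (@mulfI _ (27 : int)) => //.
  apply/eqP; rewrite -subr_eq0; apply/eqP; rewrite -[RHS]oppr0 -h hf; ring.
have eF : bdisc p r = - (3 * k ^+ 2) by rewrite -h1 hf; ring.
exists k; move: eF (h2); rewrite FE KE => eF eK.
by have /dvdzP[t ht] := dvdz_disc_square eF eK; exists t.
Qed.
End Sublattice.

(** * Heights and errors of integer points *)

Section Dev.
Variables (R : realFieldType) (xi : R).

Definition height (p : zpoint) : R := `|(pt0 p)%:~R|.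
Definition dev1 (p : zpoint) : R := (pt1 p)%:~R - (pt0 p)%:~R * xi.
Definition dev2 (p : zpoint) : R := (pt2 p)%:~R - (pt0 p)%:~R * xi ^+ 3.
Definition err (p : zpoint) : R := Num.max `|dev1 p| `|dev2 p|.
(** The linear form of the tangent to the curve at [(1, xi, xi^3)]. *)
Definition tang (p : zpoint) : R := dev2 p - 3 * xi ^+ 2 * dev1 p.
Definition curve_cst : R := 1 + 3 * `|xi| + 3 * xi ^+ 2.

Lemma curve_cst_ge1 : 1 <= curve_cst.
Proof. by have := normr_ge0 xi; have := sqr_ge0 xi; rewrite /curve_cst; lra. Qed.

Lemma norm_xi_le : `|3 * xi| <= curve_cst.
Proof.
rewrite normrM normr_nat /curve_cst.
by have := normr_ge0 xi; have := sqr_ge0 xi; lra.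
Qed.

Lemma dev1_err p : `|dev1 p| <= err p. Proof. by rewrite /err le_max lexx. Qed.
Lemma dev2_err p : `|dev2 p| <= err p. Proof. by rewrite /err le_max lexx orbT. Qed.
Lemma err_ge0 p : 0 <= err p. Proof. exact: le_trans (dev1_err p). Qed.
Lemma height_ge0 p : 0 <= height p. Proof. exact: normr_ge0. Qed.
Hint Resolve err_ge0 height_ge0 : core.

Lemma tang_err p : `|tang p| <= curve_cst * err p.
Proof.
have hx : 0 <= 3 * xi ^+ 2 by have := sqr_ge0 xi; lra.
apply: (@le_trans _ _ (err p + 3 * xi ^+ 2 * err p)).
  rewrite /tang; apply: le_norm_add; first exact: dev2_err.
  apply: le_norm_opp; rewrite normrM ger0_norm //.
  by rewrite ler_wpM2l ?dev1_err.
have -> : curve_cst * err p = err p + 3 * xi ^+ 2 * err p + 3 * (`|xi| * err p).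
  by rewrite /curve_cst; ring.
by rewrite lerDl mulr_ge0 ?ler0n // mulr_ge0.
Qed.

Lemma phi_dev p : (phi p)%:~R = (pt0 p)%:~R ^+ 2 * tang p
  - 3 * xi * (pt0 p)%:~R * dev1 p ^+ 2 - dev1 p ^+ 3 :> R.
Proof. rewrite /phi /tang /dev1 /dev2; ring. Qed.

Lemma psi_dev p q : (psi p q)%:~R = (pt0 p)%:~R ^+ 2 * tang q
  + 2 * (pt0 p)%:~R * (pt0 q)%:~R * tang p - 3 * xi * (pt0 q)%:~R * dev1 p ^+ 2
  - 2 * (3 * xi) * (pt0 p)%:~R * dev1 p * dev1 q - 3 * dev1 p ^+ 2 * dev1 q :> R.
Proof. rewrite /psi /tang /dev1 /dev2; ring. Qed.

Lemma psi_devr p q : (psi q p)%:~R = (pt0 q)%:~R ^+ 2 * tang p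
  + 2 * (pt0 p)%:~R * (pt0 q)%:~R * tang q - 3 * xi * (pt0 p)%:~R * dev1 q ^+ 2
  - 2 * (3 * xi) * (pt0 q)%:~R * dev1 p * dev1 q - 3 * dev1 q ^+ 2 * dev1 p :> R.
Proof. rewrite psi_dev; ring. Qed.

Lemma phi_le p : `|(phi p)%:~R : R| <= curve_cst * ((height p + err p) ^+ 2 * err p).
Proof.
rewrite phi_dev; apply: phi_expansion_le; rewrite ?curve_cst_ge1 ?dev1_err ?tang_err ?norm_xi_le //.
Qed.

Lemma err_le p e : `|dev1 p| <= e -> `|dev2 p| <= e -> err p <= e.
Proof. by move=> h1 h2; rewrite /err ge_max h1 h2. Qed.

Lemma dev1_comb n m p q : dev1 (comb n m p q) = n%:~R * dev1 p + m%:~R * dev1 q.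
Proof. rewrite /dev1 /=; ring. Qed.

Lemma dev2_comb n m p q : dev2 (comb n m p q) = n%:~R * dev2 p + m%:~R * dev2 q.
Proof. rewrite /dev2 /=; ring. Qed.

Lemma err_comb n m p q :
  err (comb n m p q) <= `|n%:~R| * err p + `|m%:~R| * err q.
Proof.
apply: err_le; [rewrite dev1_comb|rewrite dev2_comb]; apply: le_norm_add;
  by rewrite normrM ler_wpM2l ?dev1_err ?dev2_err.
Qed.

Lemma nonzero_point p : [|| pt0 p != 0, pt1 p != 0 | pt2 p != 0] ->
  1 <= height p \/ 1 <= err p.
Proof.
have i1 := @norm_int_ge1 R.
have [h0|/i1] := eqVneq (pt0 p) 0; last by left.
move=> /= /orP[] /i1 h; right; apply: (le_trans h).
  by apply: le_trans (dev1_err _); rewrite /dev1 h0 mul0r subr0.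
by apply: le_trans (dev2_err _); rewrite /dev2 h0 mul0r subr0.
Qed.

(** Here [p] is the lower point and [r] the higher one, which is a better
    approximation. *)
Section Pair.
Variables p r : zpoint.
Hypotheses (P1 : 1 <= height p) (PY : height p <= height r)
  (LL : err r <= err p) (L1 : err p <= 1).
Local Notation P := (height p).
Local Notation Y := (height r).
Local Notation L := (err p).
Local Notation L' := (err r).
Local Notation Z := curve_cst.

Lemma phi_le_pair : `|(phi p)%:~R : R| <= 4 * Z * (P ^+ 2 * L).
Proof.
apply: (le_trans (phi_le p)).
have -> : 4 * Z * (P ^+ 2 * L) = Z * ((P + P) ^+ 2 * L) by ring.
rewrite ler_wpM2l ?(le_trans _ curve_cst_ge1) // ler_wpM2r // lerXn2r ?nnegrE ?addr_ge0 //.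
by rewrite lerD2l (le_trans L1).
Qed.

Lemma psi_le : `|(psi p r)%:~R : R| <= 9 * Z * (P * Y * L).
Proof.
rewrite psi_dev; apply: (psi_expansion_le (L' := L')) => //;
  by rewrite ?curve_cst_ge1 ?dev1_err ?tang_err ?norm_xi_le.
Qed.

Lemma bdisc_le : `|(bdisc p r)%:~R : R|
  <= 200 * Z ^+ 2 * (Y ^+ 2 * L ^+ 4 + P ^+ 3 * Y * L * L').
Proof.
have -> : (bdisc p r)%:~R = (psi p r)%:~R ^+ 2 - 4 * (phi p)%:~R * (psi r p)%:~R :> R.
  by rewrite /bdisc; ring.
rewrite phi_dev psi_dev psi_devr; apply: disc_expansion_le => //;
  by rewrite ?curve_cst_ge1 ?dev1_err ?tang_err ?norm_xi_le.
Qed.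

Lemma polar0_le : `|(psi p r)%:~R * (pt0 p)%:~R - 2 * (phi p)%:~R * (pt0 r)%:~R : R|
   <= 6 * Z * (P ^+ 3 * L' + P * Y * L ^+ 2).
Proof.
rewrite phi_dev psi_dev; apply: polar_expansion_le => //;
  by rewrite ?curve_cst_ge1 ?dev1_err ?tang_err ?norm_xi_le.
Qed.

Lemma polar_height_le : height (polar p r) <= 6 * Z * (P ^+ 3 * L' + P * Y * L ^+ 2).
Proof.
apply: le_trans polar0_le; rewrite /height /polar /=.
rewrite [X in `|X| <= _](_ : _ = (psi p r)%:~R * (pt0 p)%:~R
  - 2 * (phi p)%:~R * (pt0 r)%:~R) //; ring.
Qed.

Lemma polar_err_le : err (polar p r) <= 17 * Z * (P * Y * L ^+ 2).
Proof.
apply: (le_trans (err_comb _ _ _ _)).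
have -> : `|(-2 * phi p)%:~R : R| = 2 * `|(phi p)%:~R|.
  by rewrite intrM normrM mulrNz normrN normr_nat.
have h1 : `|(psi p r)%:~R| * L <= 9 * Z * (P * Y * L) * L by rewrite ler_wpM2r ?psi_le.
have h2 : 2 * `|(phi p)%:~R| * L' <= 2 * (4 * Z * (P ^+ 2 * L)) * L'.
  by rewrite ler_wpM2r // ler_wpM2l // phi_le_pair.
have Z0 : 0 <= Z by apply: le_trans curve_cst_ge1.
have h3 : (8 * Z * P * L) * (P * L') <= (8 * Z * P * L) * (Y * L).
  by apply: ler_wpM2l; rewrite ?mulr_ge0 //; apply: ler_pM.
move: h1 h2 h3; move: (psi p r) (phi p) => u v; lra.
Qed.
End Pair.
End Dev.

(** * One step in a plane *)

(** The data of one step, with [p], [q] consecutive best approximations and [r]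
    the last one in their plane.  The smallness conditions hold for large heights
    as soon as the exponent is at least [19/27]; their constants only serve to
    absorb those of the previous bounds. *)
Record stage (R : realFieldType) (xi : R) (p q r : zpoint) (n m : int) : Prop := Stage {
  stage_comb : r = comb n m p q;
  stage_coprime : coprimez n m;
  stage_height1 : 1 <= height R p;
  stage_heightq : height R p <= height R q;
  stage_heightr : height R q <= height R r;
  stage_index : height R r <= 3 * `|m%:~R| * height R q;
  stage_err0 : 0 < err xi p;
  stage_err1 : err xi p <= 1;
  stage_errq : err xi q < err xi p;
  stage_errr0 : 0 < err xi r;
  stage_errr : err xi r <= err xi p;
  stage_phip : phi p != 0;
  stage_phir : phi r != 0;
  stage_small1 : 100 * curve_cst xi * (height R p ^+ 3 * err xi r) <= 1;
  stage_small2 : 100 * curve_cst xi * (height R p * err xi p ^+ 2) <= 1;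
  stage_small3 : 400 * curve_cst xi ^+ 2 * (height R p ^+ 3 * height R r * err xi p * err xi r) <= 1
}.

Section Stage.
Variables (R : realFieldType) (xi : R) (p q r : zpoint) (n m : int).
Hypothesis S : stage xi p q r n m.
Local Notation P := (height R p).
Local Notation Q := (height R q).
Local Notation Y := (height R r).
Local Notation L := (err xi p).
Local Notation L' := (err xi r).
Local Notation Z := (curve_cst xi).
Local Notation A := ((phi p)%:~R : R).
Local Notation E := ((phi r)%:~R : R).
Local Notation B := ((psi p r)%:~R : R).
Local Notation F := ((bdisc p r)%:~R : R).
Local Notation K := ((bnorm p r)%:~R : R).
Local Notation M := (`|m%:~R| : R).
Local Notation V := (P * Q * L ^+ 2).

Let P1 : 1 <= P := stage_height1 S.
Let PQ : P <= Q := stage_heightq S.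
Let QY : Q <= Y := stage_heightr S.
Let PY : P <= Y := le_trans PQ QY.
Let P0 : 0 < P := lt_le_trans ltr01 P1.
Let Q0 : 0 < Q := lt_le_trans P0 PQ.
Let Y0 : 0 < Y := lt_le_trans P0 PY.
Let L0 : 0 < L := stage_err0 S.
Let L1 : L <= 1 := stage_err1 S.
Let LL : L' <= L := stage_errr S.
Let L'0 : 0 < L' := stage_errr0 S.
Let Z1 : 1 <= Z := curve_cst_ge1 xi.
Let Z0 : 0 < Z := lt_le_trans ltr01 Z1.

Lemma stage_index_neq0 : m != 0.
Proof.
apply: contraTneq (stage_index S) => ->.
by rewrite normr0 mulr0 mul0r -ltNge.
Qed.

Let M1 : 1 <= M. Proof. exact/norm_int_ge1/stage_index_neq0. Qed.
Let A1 : 1 <= `|A|. Proof. exact/norm_int_ge1/(stage_phip S). Qed.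

Lemma stage_norm_neq0 : bnorm p r != 0.
Proof. by rewrite /bnorm mulf_neq0 ?expf_neq0 ?(stage_phip S) ?(stage_phir S). Qed.

(** The first coordinate of the polar point is small against [Y], so that
    [B P] and [2 A Y] nearly agree. *)
Lemma stage_psi : `|A| * Y <= `|B| * P /\ `|B| * P <= 3 * (`|A| * Y).
Proof.
have h := polar0_le P1 PY LL L1.
have s1 := stage_small1 S; have s2 := stage_small2 S.
have b : 6 * Z * (P ^+ 3 * L' + P * Y * L ^+ 2) <= Y.
  have s2Y : 100 * Z * (P * L ^+ 2) * Y <= 1 * Y by rewrite ler_wpM2r // ltW.
  have Y1 : 1 <= Y := le_trans P1 PY.
  have n0 : 0 <= Z * (P ^+ 3 * L') by rewrite !mulr_ge0 ?exprn_ge0 // ltW.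
  move: s1 s2Y Y1 n0; move: (P ^+ 3 * L') => u; lra.
have hA : Y <= `|A| * Y by rewrite ler_peMl // ltW.
have eB : `|B * (pt0 p)%:~R| = `|B| * P by rewrite normrM.
have eA : `|2 * A * (pt0 r)%:~R| = 2 * (`|A| * Y) by rewrite !normrM normr_nat mulrA.
have h1 := le_trans h b; rewrite -eB.
move: h1 eA hA; move: (B * _) (2 * A * _) (`|A| * Y) Y => u v w y h1 eA hA.
have t1 : `|u| <= `|u - v| + `|v| by rewrite -{1}(subrK v u) ler_normD.
have t2 : `|v| <= `|u - v| + `|u| by rewrite distrC -{1}(subrK u v) ler_normD.
by split; lra.
Qed.

Lemma stage_disc : bdisc p r != 0 ->
  `|F| <= 400 * Z ^+ 2 * (Y ^+ 2 * L ^+ 4) /\ 1 <= 400 * Z ^+ 2 * (Y ^+ 2 * L ^+ 4).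
Proof.
move=> F0; have F1 := norm_int_ge1 R F0.
have h := bdisc_le P1 PY LL L1; have s3 := stage_small3 S.
move: F1 h s3; move: (Y ^+ 2 * L ^+ 4) (P ^+ 3 * Y * L * L') F => u v f F1 h s3.
split; lra.
Qed.

(** If one of the divisible integers [F] and [F^3 + 27 K^2] vanishes, the polar
    point is congruent modulo [m] to a small multiple [k p] of [p], up to the
    factor [3]. *)
Lemma stage_exceptional_vector :
  bdisc p r = 0 \/ bdisc p r ^+ 3 + 27 * bnorm p r ^+ 2 = 0 ->
  exists k t : int, [/\ 3 * (k - n * phi p) = t * m,
     bdisc p r = 0 -> k = 0 & `|k%:~R : R| <= 20 * Z * (Y * L ^+ 2)].
Proof.
have z0 : 0 <= 20 * Z * (Y * L ^+ 2).
  by rewrite !mulr_ge0 ?exprn_ge0 ?ler0n // ltW.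
have [F0 _|F0 [/eqP|h]] := eqVneq (bdisc p r) 0.
- have [t ht] : exists t, 3 * (0 - n * phi p) = t * m.
    by apply: (@polar_divisible_disc0 p q); rewrite -(stage_comb S).
  by exists 0, t; split=> //; rewrite mulr0z normr0.
- by rewrite (negPf F0).
have [k [t [eF ht]]] : exists k t, bdisc p r = - (3 * k ^+ 2) /\ 3 * (k - n * phi p) = t * m.
  have := @polar_divisible_quadratic0 p q n m; rewrite -(stage_comb S).
  by apply=> //; exact: stage_norm_neq0.
exists k, t; split=> //; first by move/eqP; rewrite (negPf F0).
have [hF _] := stage_disc F0.
have hF' : 3 * k%:~R ^+ 2 <= 400 * Z ^+ 2 * (Y ^+ 2 * L ^+ 4).
  move: hF; rewrite eF rmorphN normrN rmorphM rmorphXn /= ger0_norm //.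
  by rewrite mulr_ge0 ?sqr_ge0.
have : `|k%:~R : R| ^+ 2 <= (20 * Z * (Y * L ^+ 2)) ^+ 2.
  rewrite real_normK ?num_real //.
  have -> : (20 * Z * (Y * L ^+ 2)) ^+ 2 = 400 * Z ^+ 2 * (Y ^+ 2 * L ^+ 4) by ring.
  have := sqr_ge0 (k%:~R : R); move: (k%:~R ^+ 2) (400 * _ * _) hF' => u v; lra.
by rewrite ler_pXn2r // nnegrE.
Qed.

(** The integer point [w], three times the quotient by [m] of the polar point minus
    [k p], has error [O(P Q L^2)], and height [O(P Q L^2)] up to a small term,
    because [|m|] is at least of the order of [Y / Q].  It is not zero, since [p]
    and [q] are independent, and a nonzero integer point has height or error at
    least [1].  When [k = 0], the bound on the error can keep the factor [A]. *)
Lemma stage_vector (k t : int) :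
  3 * (k - n * phi p) = t * m -> `|k%:~R : R| <= 20 * Z * (Y * L ^+ 2) ->
  let w := comb (3 * psi p q - t) (- 6 * phi p) p q in
  [/\ height R w <= 18 * Z * (P ^+ 3 * L') + 300 * Z * V,
      err xi w <= 400 * Z * V, 1 <= 1000 * Z * V &
      (k = 0 -> err xi w * P <= 45 * (`|A| * Q * L))].
Proof.
move=> kt hk w; have [w0 w1 w2] := polar_divisible q kt.
rewrite -/w -(stage_comb S) in w0 w1 w2.
have hM : M * height R w <= 3 * (height R (polar p r) + `|k%:~R| * P).
  rewrite /height -!normrM -intrM w0 intrM (normrM 3%:~R) (_ : `|3%:~R| = 3 :> R) ?normr_nat //.
  by rewrite ler_wpM2l ?ler0n // rmorphB rmorphM /= ler_normB.
have eM : M * err xi w <= 3 * (err xi (polar p r) + `|k%:~R| * L).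
  have hc (u v s : R) : m%:~R * u = 3 * (v - k%:~R * s) -> `|v| <= err xi (polar p r) ->
      `|s| <= L -> M * `|u| <= 3 * (err xi (polar p r) + `|k%:~R| * L).
    move=> e hv hs; rewrite -normrM e normrM normr_nat ler_wpM2l ?ler0n //.
    apply: (le_trans (ler_normB _ _)); apply: lerD => //.
    by rewrite normrM ler_wpM2l.
  have [c|c] := leP `|dev1 xi w| `|dev2 xi w|.
    rewrite {1}/err (max_idPr c).
    apply: (hc _ (dev2 xi (polar p r)) (dev2 xi p)); rewrite ?dev2_err //.
    rewrite /dev2 mulrBr mulrA -!intrM w0 w2; ring.
  rewrite {1}/err (max_idPl (ltW c)).
  apply: (hc _ (dev1 xi (polar p r)) (dev1 xi p)); rewrite ?dev1_err //.
  rewrite /dev1 mulrBr mulrA -!intrM w0 w1; ring.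
have M0 : 0 < M := lt_le_trans ltr01 M1.
have hz := polar_height_le P1 PY LL L1.
have ez := polar_err_le P1 PY LL L1.
have ix := stage_index S.
have LP : L <= P := le_trans L1 P1.
have [Pge Lge] : 0 <= P /\ 0 <= L by split; exact: ltW.
set k' : R := `|k%:~R| in hk hM eM.
have k'0 : 0 <= k' by exact: normr_ge0.
have kP : k' * P <= 20 * Z * (Y * L ^+ 2) * P by rewrite ler_wpM2r.
have kL : k' * L <= 20 * Z * (Y * L ^+ 2) * P.
  exact: ler_pM.
have ZPL : 0 <= Z * P * L ^+ 2 by rewrite !mulr_ge0 ?exprn_ge0 // ltW.
have ix' : (Z * P * L ^+ 2) * Y <= (Z * P * L ^+ 2) * (3 * M * Q) by rewrite ler_wpM2l.
have MV0 : 0 <= M * (Z * V) by rewrite !mulr_ge0 ?exprn_ge0 // ltW.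
have hw : height R w <= 18 * Z * (P ^+ 3 * L') + 300 * Z * V.
  rewrite -(ler_pM2l M0); apply: (le_trans hM).
  have u0 : 0 <= Z * (P ^+ 3 * L') by rewrite !mulr_ge0 ?exprn_ge0 // ltW.
  have u1 : 1 * (Z * (P ^+ 3 * L')) <= M * (Z * (P ^+ 3 * L')) by rewrite ler_wpM2r.
  move: hz kP ix' u1 MV0; lra.
have ew : err xi w <= 400 * Z * V.
  rewrite -(ler_pM2l M0); apply: (le_trans eM).
  move: ez kL ix' MV0; lra.
split=> //.
- have wn0 : [|| pt0 w != 0, pt1 w != 0 | pt2 w != 0].
    apply: contraT; rewrite !negb_or !negbK => /and3P[/eqP a0 /eqP a1 /eqP a2].
    set u : R := (3 * psi p q - t)%:~R; set v : R := (6 * phi p)%:~R.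
    (* Otherwise [u p = v q] with [v] nonzero, while [p] has height at most that
       of [q] and a larger error. *)
    have cf (a b : int) : (3 * psi p q - t) * a + - 6 * phi p * b = 0 ->
        u * a%:~R = v * b%:~R.
      move=> e; apply/eqP; rewrite -subr_eq0 /u /v -!intrM -rmorphB /= intr_eq0 -e.
      by apply/eqP; ring.
    have {}a0 := cf _ _ a0; have {}a1 := cf _ _ a1; have {}a2 := cf _ _ a2.
    have v0 : 0 < `|v| by rewrite normr_gt0 intr_eq0 mulf_neq0 // (stage_phip S).
    have b0 : `|u| * P = `|v| * Q by rewrite /height -!normrM a0.
    have b1 : `|u| * `|dev1 xi p| = `|v| * `|dev1 xi q|.
      by rewrite -!normrM /dev1 !mulrBr !mulrA a0 a1.
    have b2 : `|u| * `|dev2 xi p| = `|v| * `|dev2 xi q|.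
      by rewrite -!normrM /dev2 !mulrBr !mulrA a0 a2.
    have b : `|u| * L <= `|v| * err xi q.
      rewrite /err /Num.max; case: ifP => _; rewrite ?b1 ?b2 ler_wpM2l //;
      [exact: dev2_err|exact: dev1_err].
    have : `|v| * err xi q < `|v| * L by rewrite ltr_pM2l // (stage_errq S).
    move=> /(le_lt_trans b); rewrite ltr_pM2r // => uv.
    have : `|v| * P <= `|u| * P by rewrite b0 ler_wpM2l.
    by rewrite ler_pM2r // leNgt uv.
  have s1 := stage_small1 S.
  have V0 : 0 <= Z * V by rewrite !mulr_ge0 ?exprn_ge0 // ltW.
  have [h|h] := nonzero_point xi wn0.
    have := le_trans h hw; move: s1 V0; lra.
  have := le_trans h ew; move: V0; lra.
move=> k0; move: eM; rewrite /k' k0 mulr0z normr0 mul0r addr0 => eM.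
have [_ hB] := stage_psi.
have hp : err xi (polar p r) * P <= 5 * (`|A| * (Y * L)).
  have -> : 5 * (`|A| * (Y * L)) = (3 * (`|A| * Y)) * L + (2 * `|A|) * (Y * L) by ring.
  apply: (@le_trans _ _ ((`|B| * P) * L + (2 * `|A|) * (P * L'))); last first.
    apply: lerD; first by rewrite ler_wpM2r // ltW.
    by rewrite ler_wpM2l ?mulr_ge0 ?ler0n //; apply: ler_pM => //; exact: ltW.
  have -> : (`|B| * P) * L + (2 * `|A|) * (P * L') = (`|B| * L + 2 * `|A| * L') * P by ring.
  rewrite ler_wpM2r //; apply: (le_trans (err_comb _ _ _ _ _)).
  by rewrite intrM mulrNz normrM normrN normr_nat.
rewrite -(ler_pM2l M0) mulrA.
have eMP := ler_wpM2r (ltW P0) eM.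
have ix2 : (`|A| * L) * Y <= (`|A| * L) * (3 * M * Q).
  by rewrite ler_wpM2l ?mulr_ge0 // ltW.
move: eMP hp ix2; lra.
Qed.

Lemma stage_exceptional :
  bdisc p r = 0 \/ bdisc p r ^+ 3 + 27 * bnorm p r ^+ 2 = 0 -> 1 <= 1000 * Z * V.
Proof.
move=> /stage_exceptional_vector[k [t [kt _ hk]]].
by have [] := stage_vector kt hk.
Qed.

(** When [F = 0], the form [phi] takes at the point [w] the value
    [- 216 A^3 E / m^3], and [m] divides [3 A] because it divides [3 n A] and is
    prime to [n].  Hence [8 |E| <= |phi w|], and [phi w] is also a nonzero integer;
    both facts are combined with the upper bound for [|phi w|]. *)
Lemma stage_disc0 : bdisc p r = 0 ->
  `|E| <= Z * (1000 * Z * V) ^+ 3 /\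
  P <= 45 * Z * (1000 * Z * V) ^+ 2 * (`|A| * Q * L).
Proof.
move=> F0; have [k [t [kt k0 hk]]] := stage_exceptional_vector (or_introl F0).
have {}k0 := k0 F0; have [hw ew V1 /(_ k0) eP] := stage_vector kt hk.
have [w0 w1 w2] := polar_divisible q kt.
move: (comb (3 * psi p q - t) (- 6 * phi p) p q) hw ew eP w0 w1 w2 => w hw ew eP.
rewrite -(stage_comb S) k0 !mul0r !subr0 => w0 w1 w2.
have hphi : m ^+ 3 * phi w = - (216 * phi p ^+ 3 * phi r).
  transitivity (27 * phi (polar p r)); last first.
    by rewrite phi_polar F0 /bnorm; ring.
  transitivity ((m * pt0 w) ^+ 2 * (m * pt2 w) - (m * pt1 w) ^+ 3).
    by rewrite /phi; ring.
  by rewrite w0 w1 w2 /phi; ring.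
have phiw0 : phi w != 0.
  have : m ^+ 3 * phi w != 0.
    rewrite hphi oppr_eq0; apply: mulf_neq0; last exact: (stage_phir S).
    by apply: mulf_neq0 => //; apply: expf_neq0; exact: (stage_phip S).
  by apply: contraNneq => ->; rewrite mulr0.
have mA : M <= 3 * `|A|.
  have dm : (m %| 3 * phi p)%Z.
    rewrite -(@Gauss_dvdzr _ n) ?(coprimez_sym m) ?(stage_coprime S) //.
    by apply/dvdzP; exists (- t); rewrite mulNr -kt k0; ring.
  have := dvdz_norm_le R (mulf_neq0 (isT : (3 : int) != 0) (stage_phip S)) dm.
  by rewrite intrM normrM normr_nat.
have W0 : 0 <= 1000 * Z * V by apply: le_trans V1.
have E8 : 8 * `|E| <= `|(phi w)%:~R|.
  have A30 : 0 < 27 * `|A| ^+ 3 by rewrite mulr_gt0 ?ltr0n ?exprn_gt0 // (lt_le_trans ltr01).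
  rewrite -(ler_pM2l A30).
  have -> : 27 * `|A| ^+ 3 * (8 * `|E|) = M ^+ 3 * `|(phi w)%:~R|.
    have e : m%:~R ^+ 3 * (phi w)%:~R = - (216 * (A ^+ 3 * E)) :> R.
      transitivity ((m ^+ 3 * phi w)%:~R : R); [ring|rewrite hphi; ring].
    transitivity `|m%:~R ^+ 3 * (phi w)%:~R : R|; last by rewrite normrM normrX.
    rewrite e normrN normrM normr_nat (normrM (A ^+ 3)) normrX; ring.
  rewrite ler_wpM2r //.
  have -> : 27 * `|A| ^+ 3 = (3 * `|A|) ^+ 3 by ring.
  by rewrite lerXn2r ?nnegrE ?normr_ge0 ?mulr_ge0.
have hphiw := phi_le xi w.
have hsum : height R w + err xi w <= 1000 * Z * V.
  have s1 := stage_small1 S; move: s1 hw ew V1; move: (P ^+ 3 * L') => u; lra.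
have hsum2 : Z * ((height R w + err xi w) ^+ 2 * err xi w)
    <= Z * ((1000 * Z * V) ^+ 2 * err xi w).
  rewrite ler_wpM2l ?(ltW Z0) // ler_wpM2r ?err_ge0 // lerXn2r ?nnegrE ?addr_ge0 //;
  [exact: height_ge0|exact: err_ge0].
have ew' : err xi w <= 1000 * Z * V.
  by apply: le_trans hsum; rewrite lerDr height_ge0.
split.
  apply: (@le_trans _ _ (8 * `|E|)); first by rewrite ler_peMl // ler1n.
  apply: (le_trans E8); apply: (le_trans hphiw); apply: (le_trans hsum2).
  by rewrite ler_wpM2l ?(ltW Z0) // [X in _ <= X]exprSr ler_wpM2l ?exprn_ge0.
have h1 : 1 <= Z * ((1000 * Z * V) ^+ 2 * err xi w).
  by apply: le_trans hsum2; apply: le_trans hphiw; exact: norm_int_ge1.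
have := ler_wpM2r (ltW P0) h1; rewrite mul1r => /le_trans; apply.
have -> : 45 * Z * (1000 * Z * V) ^+ 2 * (`|A| * Q * L)
  = Z * (1000 * Z * V) ^+ 2 * (45 * (`|A| * Q * L)) by ring.
have -> : Z * ((1000 * Z * V) ^+ 2 * err xi w) * P
  = Z * (1000 * Z * V) ^+ 2 * (err xi w * P) by ring.
by rewrite ler_wpM2l // mulr_ge0 ?exprn_ge0 //; exact: ltW.
Qed.

Lemma stage_quadratic : bdisc p r ^+ 3 + 27 * bnorm p r ^+ 2 != 0 ->
  M ^+ 2 <= `|F| ^+ 3 + 27 * `|K| ^+ 2.
Proof.
move=> h; have d : (m ^+ 2 %| bdisc p r ^+ 3 + 27 * bnorm p r ^+ 2)%Z.
  by rewrite (stage_comb S); exact: sublattice_quadratic.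
have := dvdz_norm_le R h d; rewrite rmorphXn normrX /= => /le_trans; apply.
by rewrite rmorphD rmorphM !rmorphXn /= -!normrX (le_trans (ler_normD _ _)) // lerD2l
  normrM normr_nat.
Qed.

Lemma stage_cubic_sextic : bdisc p r != 0 -> 1000 * `|K| <= `|B| ->
  M ^+ 3 <= 36 * `|K * B * F| \/ M ^+ 6 <= 50 * (`|K * B| * F ^+ 4).
Proof.
move=> F0 KB; have F1 := norm_int_ge1 R F0; have K1 := norm_int_ge1 R stage_norm_neq0.
pose u := bdisc p r ^+ 3 - 18 * bnorm p r * psi p r * bdisc p r - 135 * bnorm p r ^+ 2.
pose s := bdisc p r ^+ 2 - 3 * bnorm p r * psi p r.
have eu : u%:~R = F ^+ 3 - 18 * K * B * F - 135 * K ^+ 2 :> R by rewrite /u; ring.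
have es : s%:~R = F ^+ 2 - 3 * K * B :> R by rewrite /s; ring.
have [h|h] := leP (F ^+ 2) (17 * `|K * B|); [left|right].
  have [] := cubic_relation_size K1 F1 KB h; rewrite /= -eu => u0.
  apply: le_trans; rewrite intr_eq0 in u0.
  rewrite -normrX -rmorphXn /=; apply: dvdz_norm_le => //.
  by rewrite /u (stage_comb S); exact: sublattice_cubic.
have [] := sextic_relation_size K1 F1 KB h; rewrite /= -eu -es -!rmorphXn -rmorphB /= => u0.
apply: le_trans; rewrite intr_eq0 in u0.
rewrite -normrX -rmorphXn /=; apply: dvdz_norm_le => //.
by rewrite /u /s (stage_comb S); exact: sublattice_sextic.
Qed.
End Stage.

(** * Linear inequalities between logarithms *)

(** The notation of this part: [a], [b], [J], [b'] are the logarithms of the heights of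
    [p], [q], [r] and of the successor of [r]; [l], [l'] are minus the logarithms of the
    errors of [p] and [r]; [al], [be] are the logarithms of [|phi p|] and
    [|phi r|]; [C] bounds the logarithms of all constants.  This is the case
    [F = 0]. *)
Definition degenerate (R : realFieldType) (C a b l al J be : R) : Prop :=
  [/\ 0 <= a + b - 2 * l + C, be <= 3 * (a + b - 2 * l) + C &
      0 <= 2 * (a + b - 2 * l) + al + b - l - a + C].

(** The case [F <> 0].  Then [1 <= |F|] gives the first inequality.  Next, either
    [F^3 + 27 K^2 = 0], or this integer bounds [m^2]; moreover [|B|] is not much
    larger than [|K|], or the cubic or the sextic relation bounds [m].  The
    logarithm of [|m|] is at least [J - b] up to a constant. *)
Definition generic (R : realFieldType) (C a b l al J be : R) : Prop :=
  0 <= J - 2 * l + C /\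
  (0 <= a + b - 2 * l + C \/
   ((2 * (J - b) <= 3 * (2 * J - 4 * l) + C \/ J - b <= 2 * al + be + C) /\
    [\/ J - a <= 2 * al + be + C,
        3 * (J - b) <= (2 * al + be) + (al + J - a) + (2 * J - 4 * l) + C |
        6 * (J - b) <= (2 * al + be) + (al + J - a) + 4 * (2 * J - 4 * l) + C])).

(** Consequences of the definition of the sequence and of the exponent [lam].
    [link_det] combines the two estimates of [m] by the height of [r] and by a
    determinant. *)
Record link (R : realFieldType) (lam C a b l al J b' l' be : R) : Prop := Link {
  link_a0 : 0 <= a;
  link_ab : a <= b;
  link_bJ : b <= J;
  link_Jb : J <= b';
  link_l : lam * b - C <= l;
  link_l' : lam * b' - C <= l';
  link_det : J - b <= b' - l - l' + C;
  link_al0 : 0 <= al;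
  link_al : al <= 2 * a - l + C;
  link_be0 : 0 <= be;
  link_be : be <= 2 * J - l' + C
}.

Section Rough.
Variables (R : realFieldType).
Implicit Types lam C a b l al J be : R.

(** The rough estimates below only use [19/27], a rational number slightly
    smaller than [mu]; the factors [2.37], [2.66], [1.61], [2.75] are what it yields,
    rounded down. *)
Lemma link_lam lam C a b l al J b' l' be : 19 / 27 <= lam ->
  link lam C a b l al J b' l' be -> link (19 / 27) C a b l al J b' l' be.
Proof.
move=> h [] a0 ab bJ Jb hl hl' *; split=> //.
  by apply: le_trans hl; rewrite lerD2r ler_wpM2r // (le_trans a0).
by apply: le_trans hl'; rewrite lerD2r ler_wpM2r //; lra.
Qed.

Lemma link_growth C a b l al J b' l' be : 0 <= C -> 0 < a -> 4000 * C <= a ->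
  link (19 / 27) C a b l al J b' l' be -> 237 / 100 * J <= b'.
Proof. move=> C0 a0 Ca []; lra. Qed.

Lemma link_no_degenerate C a b l al J b' l' be : 0 <= C -> 0 < a -> 4000 * C <= a ->
  link (19 / 27) C a b l al J b' l' be -> 266 / 100 * a <= b ->
  0 <= a + b - 2 * l + C -> False.
Proof. move=> C0 a0 Ca []; lra. Qed.

Lemma degenerate_twice C a b l al J b' l' be : 0 <= C -> 0 < a -> 4000 * C <= a ->
  link (19 / 27) C a b l al J b' l' be -> 237 / 100 * a <= b ->
  degenerate C a b l al J be ->
  0 <= J + b' - 2 * l' + C ->
  0 <= 2 * (J + b' - 2 * l') + be + b' - l' - J + C -> False.
Proof.
move=> C0 a0 Ca lk hb [z1 z2 z3] z1' z3'; have := link_growth C0 a0 Ca lk.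
case: lk; lra.
Qed.

Lemma generic_growth C a b l al J b' l' be : 0 <= C -> 0 < a -> 4000 * C <= a ->
  link (19 / 27) C a b l al J b' l' be -> generic C a b l al J be ->
  266 / 100 * J <= b'.
Proof. by move=> C0 a0 Ca lk [g1 _]; case: lk; lra. Qed.

Lemma generic_growth2 C a b l al J b' l' be : 0 <= C -> 0 < a -> 4000 * C <= a ->
  link (19 / 27) C a b l al J b' l' be -> generic C a b l al J be ->
  266 / 100 * a <= b -> 161 / 100 * b <= J /\ 275 / 100 * J <= b'.
Proof.
move=> C0 a0 Ca lk [g1 g2] hb.
case: g2 => [/(link_no_degenerate C0 a0 Ca lk hb)//|[g2 _]].
have h : 2 * (J - b) <= 3 * (2 * J - 4 * l) + C.
  case: g2 => // g2; case: lk; lra.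
by split; case: lk; lra.
Qed.

(** Once [b >= 2.75 a], the bound of [|B|] by [|K|] and the cubic relation contradict
    the inequalities of [link], so the sextic relation remains. *)
Lemma generic_main C a b l al J b' l' be : 0 <= C -> 0 < a -> 4000 * C <= a ->
  link (19 / 27) C a b l al J b' l' be -> generic C a b l al J be ->
  275 / 100 * a <= b ->
  6 * (J - b) <= (2 * al + be) + (al + J - a) + 4 * (2 * J - 4 * l) + C.
Proof.
move=> C0 a0 Ca lk g hb.
have hb' : 266 / 100 * a <= b by case: lk; lra.
have [hJ _] := generic_growth2 C0 a0 Ca lk g hb'.
case: g => g1 [/(link_no_degenerate C0 a0 Ca lk hb')//|[_ []]] // g2.
  by case: lk; lra.
by case: lk; lra.
Qed.
End Rough.

(** All logarithms are divided by [b]: [r = a / b], [w = J / b], [v = b' / b], and the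
    goal is [J / b' < a / b].  The inequality with [19 lam] is the sextic one,
    where [al], [be], [l], [l'] are replaced by their extreme values; the next one
    is the determinant bound.  Eliminating [v] between them bounds [w] from below
    ([hw]), and eliminating [v] from [r v - w] by the determinant bound gives
    [(5 - 6 lam) (1 - lam) (r v - w) >= - 5 r^2 + (19 lam - 6) r - (1 - lam) (18 lam - 6)]
    up to errors in [e].  The right-hand side increases with [r] in the relevant
    range, and at the least value [r = lam / 2] it is
    [3/4 (35 lam^2 - 36 lam + 8)]: this is where the bound [mu] comes from. *)
Lemma normalized_descent (R : realFieldType) (lam th e r w v : R) :
  19 / 27 <= lam -> lam <= 704 / 1000 -> th = 35 * lam ^+ 2 - 36 * lam + 8 -> 0 < th ->
  0 <= e -> 100 * e <= th ->
  lam * v <= 5 * r + 5 * w + 6 - 19 * lam + 28 * e ->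
  w <= (1 - lam) * (1 + v) + 3 * e ->
  lam / 2 - e <= r -> r <= 4 / 11 -> lam * v <= 2 * w + 2 * e -> 0 <= v ->
  th / 20 * v <= r * v - w.
Proof.
move=> l0 l1 hth th0 e0 eth h1 h2 r0 r1 h3 v0.
have thle : th <= 1 / 10 by rewrite hth; nra.
have e1 : e <= 1 / 1000 by lra.
have hw : (1 - lam) * ((18 * lam - 6) - 5 * r) - 40 * e <= (5 - 6 * lam) * w.
  have : lam * w <= lam * ((1 - lam) * (1 + v) + 3 * e) by rewrite ler_wpM2l //; lra.
  have : (1 - lam) * (lam * v) <= (1 - lam) * (5 * r + 5 * w + 6 - 19 * lam + 28 * e).
    by rewrite ler_wpM2l //; lra.
  have : lam * e <= 1 * e by rewrite ler_wpM2r //; lra.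
  have : 0 <= lam * e by rewrite mulr_ge0 //; lra.
  lra.
set u := r - (1 - lam); have u0 : 0 <= u by rewrite /u; lra.
have u1 : u <= 1 / 10 by rewrite /u; lra.
have q0 : th / 2 <= - 5 * r ^+ 2 + (19 * lam - 6) * r - (1 - lam) * (18 * lam - 6).
  have -> : - 5 * r ^+ 2 + (19 * lam - 6) * r - (1 - lam) * (18 * lam - 6)
     = 3 / 4 * th + (r - lam / 2) * (19 * lam - 6 - 5 * r - 5 / 2 * lam).
    by rewrite hth; field; rewrite ?pnatr_eq0.
  have : - e * 5 <= (r - lam / 2) * (19 * lam - 6 - 5 * r - 5 / 2 * lam).
    set x := r - lam / 2; set y := (X in x * X).
    have y0 : 0 <= y by rewrite /y; lra.
    have y1 : y <= 5 by rewrite /y; lra.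
    have x0 : - e <= x by rewrite /x; lra.
    have : - e * y <= x * y by rewrite ler_wpM2r.
    have : e * y <= e * 5 by rewrite ler_wpM2l.
    lra.
  lra.
have k1 : ((1 - lam) * ((18 * lam - 6) - 5 * r) - 40 * e) * u <= ((5 - 6 * lam) * w) * u.
  by rewrite ler_wpM2r.
have k2 : r * (w - 3 * e) <= r * ((1 - lam) * (1 + v)) by rewrite ler_wpM2l //; lra.
have k3 : (5 - 6 * lam) * (r * (w - 3 * e)) <= (5 - 6 * lam) * (r * ((1 - lam) * (1 + v))).
  by rewrite ler_wpM2l //; lra.
have k4 : 40 * e * u <= 4 * e.
  have : e * u <= e * (1 / 10) by rewrite ler_wpM2l.
  lra.
have k5 : (5 - 6 * lam) * (r * e) <= e.
  have : (5 - 6 * lam) * r <= 1 * 1 by clear -l0 l1 r0 r1 e1; apply: ler_pM; lra.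
  move=> h; have : ((5 - 6 * lam) * r) * e <= (1 * 1) * e by rewrite ler_wpM2r.
  lra.
have key : (1 - lam) * (th / 2) - 7 * e <= (5 - 6 * lam) * (1 - lam) * (r * v - w).
  have k6 : (1 - lam) * (th / 2)
      <= (1 - lam) * (- 5 * r ^+ 2 + (19 * lam - 6) * r - (1 - lam) * (18 * lam - 6)).
    by apply: ler_wpM2l; [lra|exact: q0].
  have -> : (5 - 6 * lam) * (1 - lam) * (r * v - w)
     = ((5 - 6 * lam) * (r * ((1 - lam) * (1 + v))) - (5 - 6 * lam) * (r * (w - 3 * e)))
     + ((5 - 6 * lam) * w * u - ((1 - lam) * ((18 * lam - 6) - 5 * r) - 40 * e) * u)
     + (1 - lam) * (- 5 * r ^+ 2 + (19 * lam - 6) * r - (1 - lam) * (18 * lam - 6))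
     - 40 * e * u - 3 * ((5 - 6 * lam) * (r * e)).
    rewrite /u; ring.
  rewrite -subr_ge0 in k1; rewrite -subr_ge0 in k3.
  move: k1 k3 k4 k5 k6; clear.
  move: (_ * w * u - _) ((5 - 6 * lam) * (r * ((1 - lam) * (1 + v))) - _) (40 * e * u)
    ((5 - 6 * lam) * (r * e)) ((1 - lam) * (th / 2)) ((1 - lam) * (- _ * _ + _ - _)).
  move=> a b c d f g; lra.
have lth : 296 / 1000 * th <= (1 - lam) * th by rewrite ler_wpM2r ?(ltW th0) //; lra.
have g0 : 0 < (5 - 6 * lam) * (1 - lam) by apply: mulr_gt0; lra.
have g1 : (5 - 6 * lam) * (1 - lam) <= (78 / 100) * (3 / 10) by clear -l0 l1; apply: ler_pM; lra.
have x0 : 0 < r * v - w.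
  rewrite -(pmulr_rgt0 _ g0); lra.
have x1 : (5 - 6 * lam) * (1 - lam) * (r * v - w) <= (78 / 100) * (3 / 10) * (r * v - w).
  by rewrite ler_wpM2r // ltW.
have v6 : v <= 6.
  have hlv : 19 / 27 * v <= lam * v by rewrite ler_wpM2r.
  have : (1 - lam) * (1 + v) <= 8 / 27 * (1 + v) by apply: ler_wpM2r; clear -v0 l0; lra.
  by clear -hlv h2 h3 e1; lra.
have tv : th * v <= th * 6 by rewrite ler_wpM2l // ltW.
move: key lth x1 eth tv th0; move: (r * v - w) => x.
by clear; lra.
Qed.

(** * Descent of the ratio of logarithms *)

Lemma le_of_eq (R : numDomainType) (x y : R) : x = y -> x <= y.
Proof. by move->. Qed.

Lemma ratio_descent (R : realFieldType) (lam th C a b l al J b' l' be : R) :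
  19 / 27 <= lam -> lam <= 704 / 1000 -> th = 35 * lam ^+ 2 - 36 * lam + 8 -> 0 < th ->
  0 <= C -> 0 < a -> 100 * C <= th * a ->
  link lam C a b l al J b' l' be ->
  6 * (J - b) <= (2 * al + be) + (al + J - a) + 4 * (2 * J - 4 * l) + C ->
  275 / 100 * a <= b -> J / b' <= a / b - th / 20.
Proof.
move=> l0 l1 hth th0 C0 a0 Ca [_ ab bJ Jb hl hl' hdet al0 hal be0 hbe] hm hb.
have b0 : 0 < b by lra.
have b'0 : 0 < b' by lra.
have bn : b != 0 by rewrite gt_eqF.
have ib : 0 <= b^-1 by rewrite invr_ge0 ltW.
have [B bE] : exists B, b^-1 = B by exists b^-1.
have bB : b * B = 1 by rewrite -bE divff.
rewrite bE in ib.
have mulB (x y : R) : x <= y -> x * B <= y * B by move=> h; rewrite ler_wpM2r.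
have v0 : 0 < b' * B by rewrite -bE divr_gt0.
have := @normalized_descent R lam th (C * B) (a * B) (J * B) (b' * B) l0 l1 hth th0.
have e0 : 0 <= C * B by rewrite mulr_ge0.
have e1 : 100 * (C * B) <= th.
  have h : 100 * C <= th * b by apply: (le_trans Ca); rewrite ler_wpM2l // ltW.
  by have := mulB _ _ h; rewrite -mulrA -[th * b * B]mulrA bB mulr1.
have h1 : lam * (b' * B) <= 5 * (a * B) + 5 * (J * B) + 6 - 19 * lam + 28 * (C * B).
  have h : lam * b' <= 5 * a + 5 * J + 6 * b - 19 * (lam * b) + 28 * C by lra.
  have := mulB _ _ h; rewrite -mulrA => /le_trans; apply; apply: le_of_eq.
  transitivity (5 * (a * B) + 5 * (J * B) + 6 * (b * B) - 19 * lam * (b * B) + 28 * (C * B)); first by ring.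
  by rewrite bB !mulr1.
have h2 : J * B <= (1 - lam) * (1 + b' * B) + 3 * (C * B).
  have h : J <= (1 - lam) * (b + b') + 3 * C by lra.
  have := mulB _ _ h => /le_trans; apply; apply: le_of_eq.
  transitivity ((1 - lam) * (b * B + b' * B) + 3 * (C * B)); first by ring.
  by rewrite bB.
have h3 : lam / 2 - C * B <= a * B.
  have h : lam * b - 2 * C <= 2 * a by lra.
  have := mulB _ _ h; rewrite mulrBl -[lam * b * B]mulrA bB mulr1; lra.
have h4 : a * B <= 4 / 11.
  have h : 11 * a <= 4 * b by lra.
  have := mulB _ _ h; rewrite -!mulrA bB mulr1; lra.
have h5 : lam * (b' * B) <= 2 * (J * B) + 2 * (C * B).
  have h : lam * b' <= 2 * J + 2 * C by lra.
  have := mulB _ _ h; rewrite -mulrA => /le_trans; apply; apply: le_of_eq; ring.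
move=> /(_ e0 e1 h1 h2 h3 h4 h5 (ltW v0)) h.
have -> : J / b' = (J * B) / (b' * B).
  rewrite invfM -bE invrK mulrACA mulVf // mulr1 //.
rewrite ler_pdivrMr // mulrBl bE; lra.
Qed.

(** A whole sequence of steps: the logarithms [J], [b'], [l'], [be] of a step are the
    [a], [b], [l], [al] of the next one. *)
Section Chain.
Variables (R : archiRealFieldType) (lam th C : R) (a b l al : nat -> R).
Hypotheses (l0 : 19 / 27 <= lam) (l1 : lam <= 704 / 1000)
  (hth : th = 35 * lam ^+ 2 - 36 * lam + 8) (th0 : 0 < th) (C0 : 0 <= C).
Hypothesis a_infty : forall M, exists N, forall s, (N <= s)%N -> M <= a s.
Hypothesis links : forall s, link lam C (a s) (b s) (l s) (al s)
  (a s.+1) (b s.+1) (l s.+1) (al s.+1).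
Hypothesis alternative : exists N, forall s, (N <= s)%N ->
  degenerate C (a s) (b s) (l s) (al s) (a s.+1) (al s.+1) \/
  generic C (a s) (b s) (l s) (al s) (a s.+1) (al s.+1).

(** Two consecutive steps cannot both be degenerate, so a generic step occurs.  It
    forces [b >= 2.66 a] in the next step, which can then not be degenerate; thus all
    later steps are generic.  From there on, the sextic inequality holds at each
    step, and the ratio [a / b >= 0] would decrease by a fixed amount infinitely
    often. *)
Lemma no_chain : False.
Proof.
have [N hN] : exists N, forall s, (N <= s)%N -> [/\ 0 < a s, 4000 * C <= a s,
    100 * C <= th * a s &
    degenerate C (a s) (b s) (l s) (al s) (a s.+1) (al s.+1) \/
    generic C (a s) (b s) (l s) (al s) (a s.+1) (al s.+1)].
  have [N1 h1] := alternative; have [N2 h2] := a_infty 1.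
  have [N3 h3] := a_infty (4000 * C); have [N4 h4] := a_infty (100 * C / th).
  exists (maxn (maxn N1 N2) (maxn N3 N4)) => s.
  rewrite !geq_max => /andP[/andP[s1 s2] /andP[s3 s4]]; split; [|exact: h3| |exact: h1].
    by apply: lt_le_trans (h2 _ s2).
  by have := h4 _ s4; rewrite ler_pdivrMr // [a s * th]mulrC.
have lk s := link_lam l0 (links s).
pose G s := generic C (a s) (b s) (l s) (al s) (a s.+1) (al s.+1).
have [s0 Ns0 g0] : exists2 s, (N <= s)%N & G s.
  have hs i : (N <= N + i)%N by exact: leq_addr.
  have [p0 p1 _ _] := hN _ (hs 0%N).
  have [q0 q1 _ [d1|]] := hN _ (hs 1%N); last by exists (N + 1)%N.
  have [_ _ _ [d2|]] := hN _ (hs 2%N); last by exists (N + 2)%N.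
  rewrite addn0 in p0 p1; rewrite !addn2 in d2; rewrite !addn1 in q0 q1 d1.
  case: d2 => z1 _ z3.
  by case: (degenerate_twice C0 q0 q1 (lk N.+1) (link_growth C0 p0 p1 (lk N)) d1 z1 z3).
have all_generic k : G (s0 + k)%N /\ 266 / 100 * a (s0 + k).+1 <= b (s0 + k).+1.
  elim: k => [|k [gk bk]].
    rewrite addn0; split=> //; have [p0 p1 _ _] := hN _ Ns0.
    exact: generic_growth C0 p0 p1 (lk _) g0.
  have hs : (N <= (s0 + k).+1)%N by rewrite -addnS (leq_trans Ns0) ?leq_addr.
  rewrite addnS; have [p0 p1 _ [[z1 _ _]|gk']] := hN _ hs.
    by case: (link_no_degenerate C0 p0 p1 (lk _) bk z1).
  by split=> //; exact: generic_growth C0 p0 p1 (lk _) gk'.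
pose t k := (s0 + k).+2.
have step k : a (t k).+1 / b (t k).+1 <= a (t k) / b (t k) - th / 20.
  have [g1 _] := all_generic k.+2; have [g2 _] := all_generic k.+1.
  have [_ b1] := all_generic k.
  rewrite !addnS in g1 g2.
  have hs1 : (N <= (s0 + k).+1)%N by rewrite -addnS (leq_trans Ns0) ?leq_addr.
  have [p0 p1 _ _] := hN _ hs1; have [q0 q1 q2 _] := hN _ (leqW hs1).
  have [_ b2] := generic_growth2 C0 p0 p1 (lk _) g2 b1.
  apply: (ratio_descent l0 l1 hth th0 C0 q0 q2 (links _)) => //.
  exact: generic_main C0 q0 q1 (lk _) g1 b2.
have bound k : a (t k) / b (t k) <= a (t 0%N) / b (t 0%N) - k%:R * (th / 20).
  elim: k => [|k IH]; first by rewrite mul0r subr0.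
  have := step k; rewrite /t !addnS -/(t k) => h; apply: (le_trans h).
  by rewrite -[k.+1%:R]natr1 mulrDl mul1r opprD addrA lerD2r.
have pos k : 0 <= a (t k) / b (t k).
  by have [? ? *] := links (t k); apply: divr_ge0 => //; apply: le_trans (_ : a (t k) <= _).
pose c := a (t 0%N) / b (t 0%N).
have := bound (Num.bound (c / (th / 20))).
have th20 : 0 < th / 20 by rewrite divr_gt0.
have c0 : 0 <= c / (th / 20) by apply: divr_ge0; [exact: pos|exact: ltW].
have := archi_boundP c0; rewrite ltr_pdivrMr //.
have := pos (Num.bound (c / (th / 20))); rewrite -/c; lra.
Qed.
End Chain.

From mathcomp Require Import all_classical all_reals all_analysis.

(** * Best approximations *)

Definition nearest (R : realType) (x : R) : int := Num.floor (x + 1 / 2).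

Lemma nearest_half (R : realType) (x : R) : `|(nearest x)%:~R - x| <= 1 / 2.
Proof.
have h1 := floor_le_tmp (x + 1 / 2); have h2 := floorD1_gt (x + 1 / 2).
rewrite -/(nearest x) in h1 h2; rewrite intrD in h2.
rewrite ler_norml; apply/andP; split; lra.
Qed.

Lemma nearest_le (R : realType) (x : R) (z : int) : `|(nearest x)%:~R - x| <= `|z%:~R - x|.
Proof.
have h := nearest_half x; have [->//|nz] := eqVneq z (nearest x).
have : 1 <= `|(z - nearest x)%:~R : R| by apply: norm_int_ge1; rewrite subr_eq0.
have : `|(z - nearest x)%:~R| <= `|z%:~R - x| + `|(nearest x)%:~R - x|.
  rewrite intrB [X in `|X| <= _](_ : _ = (z%:~R - x) - ((nearest x)%:~R - x)); last by ring.
  exact: ler_normB.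
lra.
Qed.

Section Minimal.
Variables (R : realType) (xi : R).
Local Notation err := (err xi).
Local Notation dev1 := (dev1 xi).
Local Notation dev2 := (dev2 xi).

Definition best (N : nat) : zpoint :=
  ZPoint N%:Z (nearest (N%:R * xi)) (nearest (N%:R * xi ^+ 3)).

Lemma height_best N : height R (best N) = N%:R.
Proof. by rewrite /height /= ger0_norm. Qed.

Lemma err_best_half N : err (best N) <= 1 / 2.
Proof. by apply: err_le; rewrite /dev1 /dev2 /=; exact: nearest_half. Qed.

Lemma err_best_pos p : 0 <= pt0 p -> err (best `|pt0 p|%N) <= err p.
Proof.
case: p => x y z /= x0; rewrite (_ : best _ = ZPoint x (nearest (x%:~R * xi)) (nearest (x%:~R * xi ^+ 3))).
  by apply: err_le; [apply: le_trans (dev1_err _ _)|apply: le_trans (dev2_err _ _)];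
    exact: nearest_le.
by rewrite /best (_ : (`|x|%N)%:R = x%:~R :> R) ?gez0_abs // -{2}(gez0_abs x0).
Qed.

Definition opp_zpoint (p : zpoint) := ZPoint (- pt0 p) (- pt1 p) (- pt2 p).

Lemma err_opp_zpoint p : err (opp_zpoint p) = err p.
Proof.
rewrite /err /dev1 /dev2 /=; congr (Num.max _ _).
  by rewrite -normrN; congr `|_|; ring.
by rewrite -normrN; congr `|_|; ring.
Qed.

Lemma err_best p : err (best `|pt0 p|%N) <= err p.
Proof.
have [h|h] := leP 0 (pt0 p); first exact: err_best_pos.
have := @err_best_pos (opp_zpoint p); rewrite /= oppr_ge0 (ltW h) err_opp_zpoint abszN; exact.
Qed.

Lemma err_pt0_eq0 p : pt0 p = 0 -> [|| pt0 p != 0, pt1 p != 0 | pt2 p != 0] -> 1 <= err p.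
Proof.
move=> h0 /(nonzero_point xi)[|//]; rewrite /height h0 normr0 => h.
by have := lt_le_trans ltr01 h; rewrite ltxx.
Qed.

(** The errors of the best points have no minimum, which provides the infinite sequence of
    denominators whose point is better than all those before it. *)
Hypothesis improvable : forall N, exists N', err (best N'.+1) < err (best N.+1).

Definition next_den N := ex_minn (improvable N).
Definition den k := (iter k next_den 0%N).+1.
Definition minpt k := best (den k).

Lemma den_gt0 k : (0 < den k)%N. Proof. by []. Qed.

Lemma err_minpt_lt k : err (minpt k.+1) < err (minpt k).
Proof. by rewrite /minpt /den /= /next_den; case: ex_minnP. Qed.

Lemma den_min k N : (0 < N)%N -> (N < den k.+1)%N -> err (minpt k) <= err (best N).
Proof.
case: N => [//|N] _; rewrite /den /= /next_den; case: ex_minnP => N' _ h NN'.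
by rewrite leNgt; apply: contraTN NN' => lt; rewrite -leqNgt ltnS h.
Qed.

Lemma den_lt k : (den k < den k.+1)%N.
Proof.
have ne j : den j.+1 != den j.
  by apply: contraTneq (err_minpt_lt j) => e; rewrite /minpt e ltxx.
case: k => [|k]; first by rewrite ltn_neqAle eq_sym ne den_gt0.
rewrite ltn_neqAle eq_sym ne /= leqNgt; apply/negP => lt.
have := den_min (den_gt0 k.+2) lt; rewrite leNgt.
by rewrite (lt_trans (err_minpt_lt k.+1) (err_minpt_lt k)).
Qed.

Lemma den_ge k : (k < den k)%N.
Proof. by elim: k => [//|k IH]; apply: leq_trans (den_lt k). Qed.

Lemma den_mono i j : (i <= j)%N -> (den i <= den j)%N.
Proof.
elim: j => [|j IH]; first by rewrite leqn0 => /eqP ->.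
by rewrite leq_eqVlt => /orP[/eqP ->//|/IH h]; apply: leq_trans h (ltnW (den_lt j)).
Qed.

Lemma err_minpt_mono i j : (i <= j)%N -> err (minpt j) <= err (minpt i).
Proof.
elim: j => [|j IH]; first by rewrite leqn0 => /eqP ->.
by rewrite leq_eqVlt => /orP[/eqP ->//|/IH h]; apply: le_trans (ltW (err_minpt_lt j)) h.
Qed.

Lemma minpt_minimal k p : [|| pt0 p != 0, pt1 p != 0 | pt2 p != 0] ->
  height R p < (den k.+1)%:R -> err (minpt k) <= err p.
Proof.
move=> pn hp; have [h0|h0] := eqVneq (pt0 p) 0.
  by apply: le_trans (err_pt0_eq0 h0 pn); apply: le_trans (err_best_half _) _; lra.
apply: le_trans (err_best p); apply: den_min; first by rewrite absz_gt0.
by move: hp; rewrite /height -intr_norm -abszE ltr_nat.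
Qed.

Lemma height_minpt k : height R (minpt k) = (den k)%:R.
Proof. exact: height_best. Qed.
End Minimal.

(** * Planes of consecutive best approximations *)

Lemma half_sum_lt (R : realFieldType) (u v z : R) :
  u <= z -> v < u -> z <= 1 / 2 * u + 1 / 2 * v -> False.
Proof. lra. Qed.

Lemma half_sum_ltr (R : realFieldType) (u v : R) : u < v -> 1 / 2 * u + 1 / 2 * v < v.
Proof. lra. Qed.

Lemma det3_comb (p q r : zpoint) n m : det3 p (comb n m p q) r = m * det3 p q r.
Proof. by rewrite /det3 /=; ring. Qed.

(** Column operations replace the last two coordinates by the deviations from the
    line of [(1, xi, xi^3)]. *)
Lemma det3_le (R : realFieldType) (xi : R) (p q r : zpoint) (H L L' : R) :
  height R p <= H -> height R q <= H -> height R r <= H ->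
  err xi p <= L -> err xi q <= L' -> err xi r <= L' -> L' <= L ->
  `|(det3 p q r)%:~R : R| <= 6 * (H * (L * L')).
Proof.
move=> hp hq hr ep eq' er LL.
have [p1 p2] : `|dev1 xi p| <= L /\ `|dev2 xi p| <= L.
  by split; [apply: le_trans (dev1_err _ _) _|apply: le_trans (dev2_err _ _) _].
have [q1 q2] : `|dev1 xi q| <= L' /\ `|dev2 xi q| <= L'.
  by split; [apply: le_trans (dev1_err _ _) _|apply: le_trans (dev2_err _ _) _].
have [r1 r2] : `|dev1 xi r| <= L' /\ `|dev2 xi r| <= L'.
  by split; [apply: le_trans (dev1_err _ _) _|apply: le_trans (dev2_err _ _) _].
have -> : (det3 p q r)%:~R = (pt0 p)%:~R * (dev1 xi q * dev2 xi r - dev2 xi q * dev1 xi r)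
   - (pt0 q)%:~R * (dev1 xi p * dev2 xi r - dev2 xi p * dev1 xi r)
   + (pt0 r)%:~R * (dev1 xi p * dev2 xi q - dev2 xi p * dev1 xi q) :> R.
  by rewrite /det3 /dev1 /dev2; ring.
have H0 : 0 <= H := le_trans (height_ge0 _ _) hp.
have L'0 : 0 <= L' := le_trans (err_ge0 _ _) eq'.
rewrite /height in hp hq hr.
apply: (@le_trans _ _ (H * (L' * L' + L' * L') + H * (L * L' + L * L') + H * (L * L' + L * L'))).
  norm_bound.
have : H * (L' * L') <= H * (L * L') by rewrite ler_wpM2l // ler_wpM2r.
lra.
Qed.

Section Minimal.
Variables (R : realType) (xi : R).
Local Notation err := (err xi).
Local Notation dev1 := (dev1 xi).
Local Notation dev2 := (dev2 xi).
Hypothesis improvable : forall N, exists N', err (best xi N'.+1) < err (best xi N.+1).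
Local Notation x := (minpt improvable).
Local Notation X := (den improvable).

(** Two consecutive best approximations are linearly independent: proportional
    points have proportional heights and errors, while the errors decrease. *)
Lemma minpt_minor k : let p := x k in let q := x k.+1 in
  pt0 p * pt1 q - pt1 p * pt0 q != 0 \/ pt0 p * pt2 q - pt2 p * pt0 q != 0.
Proof.
move=> p q.
have [h1|h1] := eqVneq (pt0 p * pt1 q - pt1 p * pt0 q) 0; last by left.
have [h2|h2] := eqVneq (pt0 p * pt2 q - pt2 p * pt0 q) 0; last by right.
have hX : ((X k)%:R : R) < (X k.+1)%:R by rewrite ltr_nat den_lt.
have X0 : (0 : R) < (X k)%:R by rewrite ltr0n den_gt0.
have d1 : (X k)%:R * dev1 q = (X k.+1)%:R * dev1 p.
  have := congr1 (fun z : int => z%:~R : R) h1; rewrite /dev1 !rmorphB !rmorphM /=; lra.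
have d2 : (X k)%:R * dev2 q = (X k.+1)%:R * dev2 p.
  have := congr1 (fun z : int => z%:~R : R) h2; rewrite /dev2 !rmorphB !rmorphM /=; lra.
have e : (X k.+1)%:R * err p <= (X k)%:R * err q.
  have a0 : (0 : R) <= (X k)%:R by exact: ltW.
  have b0 : (0 : R) <= (X k.+1)%:R by rewrite ler0n.
  rewrite {1}/err /Num.max; case: ifP => _.
    by rewrite -(ger0_norm b0) -normrM -d2 normrM (ger0_norm a0) ler_wpM2l ?dev2_err.
  by rewrite -(ger0_norm b0) -normrM -d1 normrM (ger0_norm a0) ler_wpM2l ?dev1_err.
have lt := err_minpt_lt improvable k; have p0 := err_ge0 xi q.
have : (X k)%:R * err q < (X k.+1)%:R * err p.
  by apply: (@lt_trans _ _ ((X k)%:R * err p)); [rewrite ltr_pM2l|rewrite ltr_pM2r ?(le_lt_trans p0)].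
by move/lt_le_trans => /(_ _ e); rewrite ltxx.
Qed.

(** Write [w] in the basis with real coefficients and round these to integers.  The
    remainder [w'] has coefficients at most [1/2], so its height is smaller than
    that of the second point and its error smaller than that of the first one; by
    minimality it is zero. *)
Lemma minpt_basis k w : det3 (x k) (x k.+1) w = 0 ->
  exists n m, w = comb n m (x k) (x k.+1).
Proof.
move=> h.
set p := x k in h *; set q := x k.+1 in h *.
have [s [t [D [D0 e0 e1 e2]]]] : exists s t D : int, [/\ D != 0,
    D * pt0 w = s * pt0 p + t * pt0 q, D * pt1 w = s * pt1 p + t * pt1 q &
    D * pt2 w = s * pt2 p + t * pt2 q].
  move: h; case: (minpt_minor k) => hD h.
    exists (pt0 w * pt1 q - pt1 w * pt0 q), (pt0 p * pt1 w - pt1 p * pt0 w),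
      (pt0 p * pt1 q - pt1 p * pt0 q); split=> //; try by ring.
    apply/eqP; rewrite -subr_eq0; apply/eqP; rewrite -[RHS]h /det3; ring.
  exists (pt0 w * pt2 q - pt2 w * pt0 q), (pt0 p * pt2 w - pt2 p * pt0 w),
    (pt0 p * pt2 q - pt2 p * pt0 q); split=> //; try by ring.
  apply/eqP; rewrite -subr_eq0; apply/eqP; rewrite -[RHS]oppr0 -[in RHS]h /det3; ring.
pose al : R := s%:~R / D%:~R; pose be : R := t%:~R / D%:~R.
have D0' : (D%:~R : R) != 0 by rewrite intr_eq0.
have cf (a b c : int) : D * c = s * a + t * b -> c%:~R = al * a%:~R + be * b%:~R :> R.
  move=> e; apply: (mulfI D0'); rewrite -intrM e rmorphD !rmorphM /= /al /be.
  by move: D0'; move: (D%:~R) => D' D'0; field.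
pose n := nearest al; pose m := nearest be.
exists n, m.
pose w' := ZPoint (pt0 w - (n * pt0 p + m * pt0 q)) (pt1 w - (n * pt1 p + m * pt1 q))
  (pt2 w - (n * pt2 p + m * pt2 q)).
have [a12 b12] : `|al - n%:~R| <= 1 / 2 /\ `|be - m%:~R| <= 1 / 2.
  by rewrite distrC [`|be - _|]distrC; split; exact: nearest_half.
have f0 : (pt0 w')%:~R = (al - n%:~R) * (pt0 p)%:~R + (be - m%:~R) * (pt0 q)%:~R :> R.
  by rewrite /w' /= intrB (cf _ _ _ e0); ring.
have f1 : dev1 w' = (al - n%:~R) * dev1 p + (be - m%:~R) * dev1 q.
  by rewrite /dev1 f0 /w' /= intrB (cf _ _ _ e1); ring.
have f2 : dev2 w' = (al - n%:~R) * dev2 p + (be - m%:~R) * dev2 q.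
  by rewrite /dev2 f0 /w' /= intrB (cf _ _ _ e2); ring.
have hX : ((X k)%:R : R) < (X k.+1)%:R by rewrite ltr_nat den_lt.
have lt := err_minpt_lt improvable k.
have [wn|] := boolP [|| pt0 w' != 0, pt1 w' != 0 | pt2 w' != 0].
  have hw : height R w' <= 1 / 2 * height R p + 1 / 2 * height R q.
    by rewrite /height f0; apply: le_norm_add; rewrite normrM ler_wpM2r.
  have ew : err w' <= 1 / 2 * err p + 1 / 2 * err q.
    apply: err_le; rewrite ?f1 ?f2; apply: le_norm_add; apply: le_norm_mul => //;
    by rewrite ?dev1_err ?dev2_err.
  rewrite !height_minpt in hw.
  have hlt : height R w' < (X k.+1)%:R by apply: le_lt_trans hw _; exact: half_sum_ltr.
  have h4 : err p <= err w' := @minpt_minimal _ _ improvable k w' wn hlt.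
  have h5 : err q < err p := lt.
  by case: (half_sum_lt h4 h5 ew).
rewrite !negb_or !negbK !subr_eq0 => /and3P[/eqP g0 /eqP g1 /eqP g2].
by case: (w) g0 g1 g2 => w0 w1 w2 /= -> -> ->.
Qed.

(** A common divisor would give a lower point with a smaller error. *)
Lemma minpt_primitive k (d : int) : (d %| pt0 (x k.+1))%Z -> (d %| pt1 (x k.+1))%Z ->
  (d %| pt2 (x k.+1))%Z -> `|d| = 1.
Proof.
move=> /dvdzP[a ha] /dvdzP[b hb] /dvdzP[c hc].
have x0 : (0 : R) < (X k.+1)%:R by rewrite ltr0n den_gt0.
have xe : (X k.+1)%:R = a%:~R * d%:~R :> R by rewrite -intrM -ha.
have d0 : d != 0 by apply: contraTneq x0 => d0; rewrite xe d0 mulr0 ltxx.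
have a0 : a != 0 by apply: contraTneq x0 => a0; rewrite xe a0 mul0r ltxx.
have d1 := norm_int_ge1 R d0.
apply: contraTeq (err_minpt_lt improvable k) => dn1; rewrite -leNgt.
have d2 : 2 <= `|d%:~R : R|.
  by rewrite -intr_norm (_ : 2 = 2%:~R) // ler_int; have := norm_int_ge1 int d0; lia.
have eD (p : zpoint) : pt0 (x k.+1) = pt0 p * d -> pt1 (x k.+1) = pt1 p * d ->
    pt2 (x k.+1) = pt2 p * d -> err p <= err (x k.+1).
  move=> h0 h1 h2.
  have g1 : dev1 (x k.+1) = dev1 p * d%:~R by rewrite /dev1 h0 h1; ring.
  have g2 : dev2 (x k.+1) = dev2 p * d%:~R by rewrite /dev2 h0 h2; ring.
  apply: err_le; [apply: le_trans (dev1_err _ _)|apply: le_trans (dev2_err _ _)];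
  by rewrite ?g1 ?g2 normrM ler_peMr.
apply: le_trans (eD (ZPoint a b c) ha hb hc).
apply: minpt_minimal; first by rewrite /= a0.
have ha1 := norm_int_ge1 R a0.
rewrite /height /= -(ger0_norm (ltW x0)) xe normrM.
have : `|a%:~R| * 2 <= `|a%:~R| * `|d%:~R : R| by rewrite ler_wpM2l.
lra.
Qed.
End Minimal.

(** * Best approximations lie off the curve *)

(** The rational points of the cuspidal cubic are [(a^3, a^2 b, b^3)]. *)
Lemma phi0_param (p : zpoint) : pt0 p != 0 -> phi p = 0 -> exists g a b : int,
  [/\ coprimez a b, pt0 p = g * a ^+ 3, pt1 p = g * a ^+ 2 * b & pt2 p = g * b ^+ 3].
Proof.
case: p => x0 x1 x2; rewrite /phi /= => n0 h.
have {}h : x0 ^+ 2 * x2 = x1 ^+ 3 by apply/eqP; rewrite -subr_eq0 h.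
have [u [v huv]] := Bezoutz x0 x1.
have g0 : gcdz x0 x1 != 0 by rewrite gcdz_eq0 (negPf n0).
have /dvdzP[a ha] := dvdz_gcdl x0 x1; have /dvdzP[b hb] := dvdz_gcdr x0 x1.
move: (gcdz x0 x1) g0 huv ha hb => g g0 huv ha hb.
have cop : coprimez a b.
  apply/coprimezP; exists (u, v) => /=.
  by apply: (mulIf g0); rewrite mul1r -[RHS]huv ha hb; ring.
have e : a ^+ 2 * x2 = g * b ^+ 3.
  apply: (mulfI (expf_neq0 2 g0)).
  transitivity (x0 ^+ 2 * x2); first by rewrite ha; ring.
  by rewrite h hb; ring.
have /dvdzP[g' hg] : (a ^+ 2 %| g)%Z.
  have : (a ^+ 2 %| b ^+ 3 * g)%Z by rewrite mulrC -e dvdz_mulr.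
  by rewrite Gauss_dvdzr // coprimezXl // coprimezXr.
have a0 : a != 0 by apply: contra_neq n0 => a0; rewrite ha a0 mul0r.
exists g', a, b; split=> //; rewrite ?ha ?hb ?hg; try ring.
apply: (mulfI (expf_neq0 2 a0)); rewrite e hg; ring.
Qed.

Lemma minor_le (R : realFieldType) (H L : R) (u v : int) (t : R) (w z : int) :
  `|u%:~R| <= H -> `|v%:~R| <= H -> `|z%:~R - v%:~R * t| <= L -> `|w%:~R - u%:~R * t| <= L ->
  `|(u * z - v * w)%:~R : R| <= 2 * (H * L).
Proof.
move=> hu hv hz hw.
have -> : (u * z - v * w)%:~R = u%:~R * (z%:~R - v%:~R * t) - v%:~R * (w%:~R - u%:~R * t) :> R.
  by ring.
have -> : 2 * (H * L) = H * L + H * L by ring.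
by apply: (le_trans (ler_normB _ _)); apply: lerD; apply: le_norm_mul.
Qed.

(** A minor of [p] and a neighbour [y] is an integer of size [O(P L)].  If
    [phi p = 0], then [p = g (a^3, a^2 b, b^3)], and a nonzero minor is divisible by
    [g a^2] or by [g a], whose cubes are at least [P = g a^3].  Hence [P^2 L^3] is
    bounded below. *)
Lemma phi_neq0 (R : realFieldType) (xi : R) (p y : zpoint) (L : R) :
  pt0 p != 0 -> height R y <= height R p -> err xi p <= L -> err xi y <= L ->
  8 * (height R p ^+ 2 * L ^+ 3) < 1 ->
  pt0 y * pt1 p - pt0 p * pt1 y != 0 \/ pt0 y * pt2 p - pt0 p * pt2 y != 0 ->
  phi p != 0.
Proof.
move=> p0 hy ep ey small minor; apply/eqP => /(phi0_param p0) [g [a [b [cop h0 h1 h2]]]].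
set H := height R p in hy small.
have H1 : 1 <= H by exact: norm_int_ge1.
have L0 : 0 <= L by exact: le_trans (err_ge0 _ _) ep.
have g0 : g != 0 by apply: contra_neq p0 => g0; rewrite h0 g0 mul0r.
have a0 : a != 0 by apply: contra_neq p0 => a0; rewrite h0 a0 expr0n mulr0.
have HE : H = `|g%:~R| * `|a%:~R| ^+ 3.
  by rewrite /H /height h0 rmorphM rmorphXn normrM normrX.
have g1 := norm_int_ge1 R g0; have a1 := norm_int_ge1 R a0.
have b1 : `|(pt0 y * pt1 p - pt0 p * pt1 y)%:~R : R| <= 2 * (H * L).
  apply: (@minor_le _ _ _ _ _ xi) => //.
    by apply: le_trans ep; exact: dev1_err.
  by apply: le_trans ey; exact: dev1_err.
have b2 : `|(pt0 y * pt2 p - pt0 p * pt2 y)%:~R : R| <= 2 * (H * L).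
  apply: (@minor_le _ _ _ _ _ (xi ^+ 3)) => //.
    by apply: le_trans ep; exact: dev2_err.
  by apply: le_trans ey; exact: dev2_err.
have H0 : 0 < H by exact: lt_le_trans ltr01 H1.
have contra (d : R) : 0 <= d -> d <= 2 * (H * L) -> H <= d ^+ 3 -> False.
  move=> d0 dH Hd.
  have : d ^+ 3 <= (2 * (H * L)) ^+ 3.
    by rewrite lerXn2r // nnegrE !mulr_ge0 // ltW.
  move=> /(le_trans Hd); have -> : (2 * (H * L)) ^+ 3 = 8 * (H ^+ 2 * L ^+ 3) * H by ring.
  by rewrite leNgt gtr_pMl // small.
have dvd_le (d z : int) : z != 0 -> (d %| z)%Z -> `|z%:~R : R| <= 2 * (H * L) ->
    H <= `|d%:~R| ^+ 3 -> False.
  by move=> z0 dz zH; apply: contra => //; apply: le_trans zH; exact: dvdz_norm_le.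
have [m1|m1] := eqVneq (pt0 y * pt1 p - pt0 p * pt1 y) 0; last first.
  apply: (dvd_le (g * a ^+ 2) _ m1 _ b1).
    by rewrite h0 h1; apply/dvdzP; exists (pt0 y * b - a * pt1 y); ring.
  rewrite rmorphM rmorphXn normrM normrX exprMn HE -exprM.
  apply: ler_pM; rewrite ?exprn_ge0 //; first by rewrite -{1}[`|g%:~R|]expr1 ler_weXn2l.
  by rewrite ler_weXn2l.
case: minor => [/eqP//|m2].
have /dvdzP[k hk] : (a %| pt0 y)%Z.
  have : (a %| b * pt0 y)%Z.
    apply/dvdzP; exists (pt1 y); apply: (mulfI (mulf_neq0 g0 (expf_neq0 2 a0))).
    by apply/eqP; rewrite -subr_eq0; apply/eqP; rewrite -[RHS]m1 h0 h1; ring.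
  by rewrite Gauss_dvdzr.
apply: (dvd_le (g * a) _ m2 _ b2).
  by rewrite h0 h2 hk; apply/dvdzP; exists (k * b ^+ 3 - a ^+ 2 * pt2 y); ring.
rewrite rmorphM normrM exprMn HE ler_wpM2r ?exprn_ge0 //.
by rewrite -{1}[`|g%:~R|]expr1 ler_weXn2l.
Qed.

(** * Leaving a plane *)

Lemma det3_dev (R : realFieldType) (xi : R) (p q r : zpoint) :
  let u0 := pt1 p * pt2 q - pt2 p * pt1 q in
  let u1 := pt2 p * pt0 q - pt0 p * pt2 q in
  let u2 := pt0 p * pt1 q - pt1 p * pt0 q in
  (det3 p q r)%:~R = (pt0 r)%:~R * (u0%:~R + u1%:~R * xi + u2%:~R * xi ^+ 3)
    + u1%:~R * dev1 xi r + u2%:~R * dev2 xi r :> R.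
Proof. by rewrite /det3 /dev1 /dev2 /=; ring. Qed.

Section Stages.
Variables (R : realType) (xi : R).
Local Notation err := (err xi).
Hypothesis improvable : forall N, exists N', err (best xi N'.+1) < err (best xi N.+1).
Hypothesis indep : forall u0 u1 u2 : int,
  u0%:~R + u1%:~R * xi + u2%:~R * xi ^+ 3 = 0 -> [/\ u0 = 0, u1 = 0 & u2 = 0].
Local Notation x := (minpt improvable).
Local Notation X := (den improvable).

(** If all later best approximations were in the plane of [x k] and [x k.+1], so would
    be their limit direction [(1, xi, xi^3)], whose coordinates are independent. *)
Lemma plane_escape k : exists j, (k < j)%N && (det3 (x k) (x k.+1) (x j.+1) != 0).
Proof.
apply: contrapT => /forallNP h.
have {}h j : (k < j)%N -> det3 (x k) (x k.+1) (x j.+1) = 0.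
  by move=> kj; have := h j; rewrite kj /= => /negP; rewrite negbK => /eqP.
pose p := x k; pose q := x k.+1.
pose u0 := pt1 p * pt2 q - pt2 p * pt1 q.
pose u1 := pt2 p * pt0 q - pt0 p * pt2 q.
pose u2 := pt0 p * pt1 q - pt1 p * pt0 q.
pose T : R := u0%:~R + u1%:~R * xi + u2%:~R * xi ^+ 3.
pose c : R := `|u1%:~R| + `|u2%:~R|.
have c0 : 0 <= c by rewrite addr_ge0.
have T0 : T = 0.
  apply/eqP/contraT => Tn.
  have Tp : 0 < `|T| by rewrite normr_gt0.
  pose j := maxn k.+1 (Num.bound (c / `|T|)).
  have kj : (k < j)%N by rewrite leq_max ltnSn.
  have := det3_dev xi p q (x j.+1); rewrite h // -/u0 -/u1 -/u2 -/T => e.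
  have eT : (X j.+1)%:R * T = - (u1%:~R * dev1 xi (x j.+1) + u2%:~R * dev2 xi (x j.+1)).
    by apply/eqP; rewrite -subr_eq0 opprK addrA; apply/eqP; rewrite [RHS](_ : _ = 0%:~R) // e.
  have le : (X j.+1)%:R * `|T| <= c.
    rewrite -(normr_nat R (X j.+1)) -normrM eT normrN.
    have e1 : err (x j.+1) <= 1 by apply: le_trans (err_best_half _ _) _; lra.
    apply: le_norm_add; rewrite normrM ler_piMr //; apply: le_trans e1;
    by rewrite ?dev1_err ?dev2_err.
  have : (Num.bound (c / `|T|))%:R <= (X j.+1)%:R :> R.
    rewrite ler_nat; apply: leq_trans (den_ge improvable j.+1); rewrite leqW //.
    by rewrite ltnW // ltnS leq_max leqnn orbT.
  have := archi_boundP (divr_ge0 c0 (normr_ge0 T)); rewrite ltr_pdivrMr // => lt le2.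
  have := lt_le_trans lt (ler_wpM2r (ltW Tp) le2).
  by move=> /lt_le_trans/(_ le); rewrite ltxx.
have [_ z1 z2] := indep T0.
have [] := minpt_minor improvable k; rewrite -/p -/q.
  by rewrite -/u2 z2 eqxx.
by rewrite -oppr_eq0 opprB -/u1 z1 eqxx.
Qed.

Definition next_stage k := ex_minn (plane_escape k).

Lemma next_stage_lt k : (k < next_stage k)%N.
Proof. by rewrite /next_stage; case: ex_minnP => j /andP[]. Qed.

Lemma next_stage_escape k : det3 (x k) (x k.+1) (x (next_stage k).+1) != 0.
Proof. by rewrite /next_stage; case: ex_minnP => j /andP[]. Qed.

Lemma next_stage_plane k : det3 (x k) (x k.+1) (x (next_stage k)) = 0.
Proof.
rewrite /next_stage; case: ex_minnP => j /andP[kj _] jmin.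
have [->|jk] := eqVneq j k.+1; first by rewrite /det3; ring.
case: j kj jmin jk => [//|j] kj jmin jk.
apply/eqP/contraT => d.
have kj' : (k < j)%N by rewrite ltn_neqAle -ltnS kj andbT eq_sym -eqSS.
by have := jmin j; rewrite kj' d ltnn; apply.
Qed.

(** The lower bound for [m]: [n (x k)] is a combination of [x j] and [x k.+1], and
    comparing errors gives [|n| <= |m| + 1], so the height of [x j] is
    at most [3 |m|] times that of [x k.+1].  The upper bound: the determinant of
    [x k], [x j], [x j.+1] is [m] times a nonzero integer. *)
Lemma stage_step k : (0 < k)%N -> exists n m,
  [/\ x (next_stage k) = comb n m (x k) (x k.+1), coprimez n m,
    height R (x (next_stage k)) <= 3 * `|m%:~R| * height R (x k.+1) &
    `|m%:~R| <= 6 * (height R (x (next_stage k).+1) * (err (x k) * err (x (next_stage k))))].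
Proof.
move=> k0; have [n [m e]] := minpt_basis (next_stage_plane k).
have lt := next_stage_lt k; have esc := next_stage_escape k.
set j := next_stage k in e lt esc *.
have cop : coprimez n m.
  case: j lt e esc => [//|j] lt e _.
  have d1 := dvdz_gcdl n m; have d2 := dvdz_gcdr n m.
  have := @minpt_primitive _ _ improvable j (gcdz n m); rewrite e /= => h.
  have := h (rpredD (dvdz_mulr _ d1) (dvdz_mulr _ d2)) (rpredD (dvdz_mulr _ d1) (dvdz_mulr _ d2))
    (rpredD (dvdz_mulr _ d1) (dvdz_mulr _ d2)).
  by rewrite /coprimez /gcdz => /eqP.
have eqp : (0 : R) < err (x k) by apply: le_lt_trans (err_minpt_lt improvable k); exact: err_ge0.
have lt1 := err_minpt_lt improvable k.
have lte : err (x j) <= err (x k.+1) by exact: err_minpt_mono.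
have hlt : (X k)%:R < (X k.+1)%:R :> R by rewrite ltr_nat den_lt.
have hle : (X k.+1)%:R <= (X j)%:R :> R by rewrite ler_nat den_mono.
have m0 : m != 0.
  apply: contraTneq hle => m0; move: e cop; rewrite m0 => e.
  rewrite /coprimez gcdz0 => /eqP n1; rewrite -ltNge.
  have -> : (X j)%:R = (X k)%:R :> R; last by [].
  rewrite -!height_minpt e /height /= mul0r addr0 intrM normrM -intr_norm.
  by rewrite -abszE n1 mul1r.
have m1 := norm_int_ge1 R m0.
exists n, m; split=> //.
  have nm : `|n%:~R| <= `|m%:~R| + 1 :> R.
    have b : `|n%:~R| * err (x k) <= (`|m%:~R| + 1) * err (x k).
      have ex : err (comb n 0 (x k) (x k.+1)) = `|n%:~R| * err (x k).
        rewrite /err dev1_comb dev2_comb !mul0r !addr0 !normrM maxr_pMr //.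
      have -> : `|n%:~R| * err (x k) = err (comb 1 (- m) (x j) (x k.+1)).
        by rewrite -ex e /comb /=; congr (err (ZPoint _ _ _)); ring.
      apply: (le_trans (err_comb _ _ _ _ _)); rewrite rmorphN /= normrN normr1 mul1r mulrDl mul1r.
      rewrite addrC; apply: lerD; last by apply: (le_trans lte); exact: ltW.
      by rewrite ler_wpM2l // ltW.
    by move: b; rewrite ler_pM2r.
  have hj : height R (x j) <= `|n%:~R| * (X k)%:R + `|m%:~R| * (X k.+1)%:R.
    rewrite e /height /= intrD !intrM; apply: (le_trans (ler_normD _ _)).
    by rewrite !normrM !normr_nat.
  rewrite !height_minpt in hj *.
  have Xk : (0 : R) <= (X k)%:R by rewrite ler0n.
  have h1 : `|n%:~R| * (X k)%:R <= (`|m%:~R| + 1) * (X k)%:R :> R by rewrite ler_wpM2r.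
  have h2 : (`|m%:~R| + 1) * (X k)%:R <= (2 * `|m%:~R|) * (X k.+1)%:R :> R.
    by apply: ler_pM; [exact: addr_ge0|exact: Xk|lra|exact: ltW].
  move: hj h1 h2; rewrite -(mulrA 2) -(mulrA 3).
  move: (`|m%:~R| * (X k.+1)%:R) => u hj h1 h2; apply: (le_trans hj).
  have -> : 3 * u = 2 * u + u by ring.
  by rewrite lerD2r (le_trans h1).
have d : det3 (x k) (x j) (x j.+1) = m * det3 (x k) (x k.+1) (x j.+1).
  by rewrite e det3_comb.
apply: (@le_trans _ _ `|(det3 (x k) (x j) (x j.+1))%:~R|).
  by rewrite d intrM normrM ler_peMr // norm_int_ge1.
apply: (det3_le (xi := xi)) => //; rewrite ?height_minpt ?ler_nat ?den_mono //.
- by rewrite leqW // ltnW.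
- by rewrite ltW // err_minpt_lt.
- by apply: (le_trans lte); exact: ltW.
Qed.
End Stages.

(** * From a step to logarithms *)

Section StageLog.
Variables (R : realType) (xi : R) (p q r : zpoint) (n m : int).
Hypothesis S : stage xi p q r n m.
Local Notation lnz z := (ln `|z%:~R : R|).
Local Notation P := (height R p).
Local Notation Q := (height R q).
Local Notation Y := (height R r).
Local Notation L := (err xi p).
Local Notation Z := (curve_cst xi).
Variables kap a b J l al be : R.
Hypotheses (eW : 1000 * Z = expR kap) (eP : P = expR a) (eQ : Q = expR b)
  (eY : Y = expR J) (eL : L = expR (- l))
  (eA : `|(phi p)%:~R : R| = expR al) (eE : `|(phi r)%:~R : R| = expR be).

Let P0 : 0 < P. Proof. exact: lt_le_trans ltr01 (stage_height1 S). Qed.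
Let Q0 : 0 < Q. Proof. exact: lt_le_trans P0 (stage_heightq S). Qed.
Let Y0 : 0 < Y. Proof. exact: lt_le_trans Q0 (stage_heightr S). Qed.
Let norm_exp (z : int) : z != 0 -> `|z%:~R : R| = expR (lnz z).
Proof. by move=> z0; rewrite lnK // posrE normr_gt0 intr_eq0. Qed.

Let kap1 : 1000 <= expR kap.
Proof. by rewrite -eW ler_peMr ?ler0n // curve_cst_ge1. Qed.

Let kap0 : 0 <= kap.
Proof. by rewrite -ler_expR expR0 (le_trans _ kap1) // ler1n. Qed.

Let Zle : Z <= expR kap.
Proof. by rewrite -eW ler_peMl ?ler1n // (le_trans ler01) ?curve_cst_ge1. Qed.

Let Z0 : 0 <= Z. Proof. exact: le_trans ler01 (curve_cst_ge1 xi). Qed.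

Let F_exp : bdisc p r != 0 -> lnz (bdisc p r) <= 2 * kap + 2 * J - 4 * l
  /\ 0 <= 2 * kap + 2 * J - 4 * l.
Proof.
move=> F0; have [h1 h2] := stage_disc S F0.
have c : 400 * Z ^+ 2 <= expR kap ^+ 2.
  have z2 := sqr_ge0 Z; rewrite -eW exprMn; lra.
have d : 400 * Z ^+ 2 * (Y ^+ 2 * L ^+ 4) <= expR (2 * kap + 2 * J - 4 * l).
  have -> : expR (2 * kap + 2 * J - 4 * l) = expR kap ^+ 2 * (Y ^+ 2 * L ^+ 4).
    rewrite eY eL -!expRM_natl -!expRD; congr expR; ring.
  by apply: ler_wpM2r => //; apply: mulr_ge0; apply: exprn_ge0; [exact: ltW|exact: err_ge0].
split; rewrite -ler_expR ?expR0 -?norm_exp //; exact: le_trans d.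
Qed.

(** Every constant is at most a power of [1000 * curve_cst xi] with a small exponent, so
    [20 kap] bounds all their logarithms. *)
Lemma stage_log : degenerate (20 * kap) a b l al J be \/ generic (20 * kap) a b l al J be.
Proof.
have k0 := kap0.
have exc : bdisc p r = 0 \/ bdisc p r ^+ 3 + 27 * bnorm p r ^+ 2 = 0 ->
    0 <= a + b - 2 * l + kap.
  move=> /(stage_exceptional S); rewrite eW eP eQ eL -expRM_natl -!expRD -expR0 ler_expR.
  lra.
have V0 : 0 <= 1000 * Z * (P * Q * L ^+ 2).
  by rewrite eW eP eQ eL -expRM_natl -!expRD expR_ge0.
have [F0|F0] := eqVneq (bdisc p r) 0; [left|right].
  have [h1 h2] := stage_disc0 S F0.
  split; first by have := exc (or_introl F0); lra.
    have : be <= kap + 3 * (kap + (a + b - 2 * l)).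
      rewrite -ler_expR -eE; apply: (le_trans h1).
      have -> : expR (kap + 3 * (kap + (a + b - 2 * l))) = expR kap * (1000 * Z * (P * Q * L ^+ 2)) ^+ 3.
        rewrite eW eP eQ eL -!(expRM_natl 2) -!expRD -expRM_natl -expRD; congr expR; ring.
      by apply: ler_wpM2r; [exact: exprn_ge0|exact: Zle].
    lra.
  have : a <= 3 * kap + 2 * (a + b - 2 * l) + (al + b - l).
    rewrite -ler_expR -eP; apply: (le_trans h2).
    have -> : expR (3 * kap + 2 * (a + b - 2 * l) + (al + b - l))
        = expR kap * (1000 * Z * (P * Q * L ^+ 2)) ^+ 2 * (`|(phi p)%:~R| * Q * L).
      rewrite eW eP eQ eL eA -!(expRM_natl 2) -!expRD -expRM_natl -!expRD; congr expR; ring.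
    apply: ler_wpM2r; first by rewrite eA eQ eL -!expRD expR_ge0.
    apply: ler_wpM2r; first exact: exprn_ge0.
    by rewrite -eW; have := Z0; lra.
  lra.
have [f1 f2] := F_exp F0.
have K0 := stage_norm_neq0 S.
have eK : lnz (bnorm p r) = 2 * al + be.
  apply: expR_inj; rewrite -norm_exp // expRD expRM_natl -eA -eE -normrX -normrM.
  by congr `|_|; rewrite /bnorm; ring.
have [B1 B2] := stage_psi S.
have B0 : psi p r != 0.
  apply: contraTneq B1 => ->; rewrite normr0 mul0r -ltNge mulr_gt0 //.
  by rewrite normr_gt0 intr_eq0 (stage_phip S).
have be1 : J - a <= lnz (psi p r).
  have : J <= lnz (psi p r) + a.
    rewrite -ler_expR expRD -eY -eP -norm_exp //; apply: le_trans B1.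
    by rewrite ler_peMl ?(ltW Y0) // norm_int_ge1 // (stage_phip S).
  lra.
have be2 : lnz (psi p r) <= kap + al + J - a.
  have : lnz (psi p r) + a <= kap + (al + J).
    rewrite -ler_expR !expRD -eY -eP -eA -norm_exp //; apply: (le_trans B2).
    rewrite ler_wpM2r ?mulr_ge0 ?(ltW Y0) //; apply: le_trans kap1; exact: ler_nat.
  lra.
have m0 := stage_index_neq0 S.
have mu : J - b - kap <= lnz m.
  have : J <= kap + lnz m + b.
    rewrite -ler_expR !expRD -eY -eQ -norm_exp //; apply: (le_trans (stage_index S)).
    rewrite !ler_wpM2r ?(ltW Q0) //; apply: le_trans kap1; exact: ler_nat.
  lra.
split; first lra.
have [U0|U0] := eqVneq (bdisc p r ^+ 3 + 27 * bnorm p r ^+ 2) 0.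
  by left; have := exc (or_intror U0); lra.
right; split.
  have := stage_quadratic S U0; rewrite (norm_exp m0) (norm_exp F0) (norm_exp K0).
  move: (lnz m) (lnz (bdisc p r)) mu f1 => u f mu f1 h.
  have [c|c] := leP (expR f ^+ 3) (27 * expR (lnz (bnorm p r)) ^+ 2).
    have : 2 * u <= kap + 2 * (2 * al + be).
      rewrite -ler_expR expRD !expRM_natl -eK; apply: (le_trans h).
      have := sqr_ge0 (expR (lnz (bnorm p r))) => x0.
      apply: (@le_trans _ _ (1000 * expR (lnz (bnorm p r)) ^+ 2)); first by lra.
      by rewrite ler_wpM2r.
    right; lra.
  have : 2 * u <= kap + 3 * f.
    rewrite -ler_expR expRD !expRM_natl; apply: (le_trans h).
    have := exprn_ge0 3 (expR_ge0 f) => x0.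
    apply: (@le_trans _ _ (1000 * expR f ^+ 3)); first by lra.
    by rewrite ler_wpM2r.
  left; lra.
have [c|c] := leP (1000 * `|(bnorm p r)%:~R : R|) `|(psi p r)%:~R|; last first.
  apply: Or31.
  have : lnz (psi p r) <= kap + (2 * al + be).
    rewrite -ler_expR expRD -eK -!norm_exp //; apply: (le_trans (ltW c)).
    by rewrite ler_wpM2r.
  lra.
have eF := norm_exp F0.
case: (stage_cubic_sextic S F0 c) => h; [apply: Or32|apply: Or33].
  have : 3 * lnz m <= kap + lnz (bnorm p r) + lnz (psi p r) + lnz (bdisc p r).
    rewrite -ler_expR !expRD expRM_natl -!norm_exp //; apply: (le_trans h).
    rewrite !normrM !mulrA !ler_wpM2r //; apply: le_trans kap1; exact: ler_nat.
  rewrite eK; lra.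
have : 6 * lnz m <= kap + lnz (bnorm p r) + lnz (psi p r) + 4 * lnz (bdisc p r).
  rewrite -ler_expR !expRD !expRM_natl -!norm_exp //; apply: (le_trans h).
  have -> : (bdisc p r)%:~R ^+ 4 = `|(bdisc p r)%:~R : R| ^+ 4.
    by rewrite -normrX ger0_norm // -[4%N]/(2 * 2)%N exprM sqr_ge0.
  rewrite normrM !mulrA !ler_wpM2r ?exprn_ge0 //; apply: le_trans kap1; exact: ler_nat.
rewrite eK; lra.
Qed.

End StageLog.

(** * No exponent above the bound *)

(** These are the logarithms of the smallness conditions in [stage]; they hold from
    the growth [b >= 2.37 a] supplied by the previous step. *)
Lemma link_smallness (R : realFieldType) (C a b l al J b' l' be : R) :
  0 <= C -> 0 < a -> 4000 * C <= a -> link (19 / 27) C a b l al J b' l' be ->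
  237 / 100 * a <= b ->
  [/\ 3 * a - l' + C <= 0, a - 2 * l + C <= 0 & 3 * a + J - l - l' + 2 * C <= 0].
Proof.
move=> C0 a0 Ca lk hb; have := link_growth C0 a0 Ca lk.
by case: lk => *; split; lra.
Qed.

Lemma absorb_cst (R : realFieldType) (k C t : R) : 0 <= k -> 20 * k <= C ->
  t + C <= 0 -> k + t <= 0.
Proof. lra. Qed.

Lemma absorb_cst2 (R : realFieldType) (k C t : R) : 0 <= k -> 20 * k <= C ->
  t + 2 * C <= 0 -> 2 * k + t <= 0.
Proof. lra. Qed.

Lemma degenerate_le (R : realFieldType) (C C' a b l al J be : R) : C <= C' ->
  degenerate C a b l al J be -> degenerate C' a b l al J be.
Proof. by move=> h [*]; split; lra. Qed.

Lemma generic_le (R : realFieldType) (C C' a b l al J be : R) : C <= C' ->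
  generic C a b l al J be -> generic C' a b l al J be.
Proof.
move=> h [g1 g2]; split; first lra.
case: g2 => [g2|[g2 g3]]; [left; lra|right; split].
  by case: g2 => g2; [left|right]; lra.
by case: g3 => g3; [apply: Or31|apply: Or32|apply: Or33]; lra.
Qed.

Section Main.
Variables (R : realType) (xi lam c : R).
Local Notation err := (err xi).
Hypotheses (l0 : 19 / 27 <= lam) (l1 : lam <= 704 / 1000)
  (lmu : 0 < 35 * lam ^+ 2 - 36 * lam + 8) (c0 : 0 < c).
Hypothesis indep : forall u0 u1 u2 : int,
  u0%:~R + u1%:~R * xi + u2%:~R * xi ^+ 3 = 0 -> [/\ u0 = 0, u1 = 0 & u2 = 0].
Hypothesis approx : forall X : R, 1 <= X -> exists p : zpoint,
  [/\ [|| pt0 p != 0, pt1 p != 0 | pt2 p != 0], height R p <= X & err p <= c * X `^ (- lam)].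

Lemma err_best_gt0 N : 0 < err (best xi N.+1).
Proof.
rewrite lt_def err_ge0 andbT; apply/eqP => e.
have d1 : dev1 xi (best xi N.+1) = 0.
  by apply/eqP; rewrite -normr_le0 -e dev1_err.
have [|_ + _] := @indep (- pt1 (best xi N.+1)) (pt0 (best xi N.+1)) 0; last by [].
by rewrite mul0r addr0 rmorphN /= addrC -opprB -/(dev1 xi (best xi N.+1)) d1 oppr0.
Qed.

Lemma best_improves N : exists N', err (best xi N'.+1) < err (best xi N.+1).
Proof.
have e0 := err_best_gt0 N.
have e1 : err (best xi N.+1) < 1 by apply: le_lt_trans (err_best_half _ _) _; lra.
set e := err _ in e0 e1 *.
pose X := expR (Num.max 0 ((ln c - ln e) / lam + 1)).
have lamp : 0 < lam by have := l0; lra.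
have X1 : 1 <= X by rewrite -expR0 ler_expR le_max lexx.
have [p [pn hp ep]] := approx X1.
have lt : c * X `^ (- lam) < e.
  rewrite -ltr_ln ?posrE ?mulr_gt0 ?powR_gt0 ?expR_gt0 //.
  rewrite lnM ?posrE ?powR_gt0 ?expR_gt0 // ln_powR expRK mulNr.
  have : (ln c - ln e) / lam + 1 <= Num.max 0 ((ln c - ln e) / lam + 1) by rewrite le_max lexx orbT.
  move: (Num.max _ _) => M; rewrite -lerBrDr ler_pdivrMr // mulrBl mul1r [M * _]mulrC; lra.
have pe := le_lt_trans ep lt.
have p0 : pt0 p != 0.
  apply: contraTneq pe => p0; rewrite -leNgt; apply: le_trans (@err_pt0_eq0 _ xi p p0 pn).
  exact: ltW.
exists (absz (pt0 p)).-1; rewrite prednK ?absz_gt0 //.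
exact: le_lt_trans (err_best _ _) pe.
Qed.

Local Notation x := (minpt best_improves).
Local Notation X := (den best_improves).

(* [C1] comes from the constant [c] of the exponent and from halving the bound [X]
   to get strictly below the next denominator; [kap] from the curve. *)
Let C1 : R := Num.max 0 (ln c) + ln 2.
Let kap : R := ln (1000 * curve_cst xi).
Let C : R := C1 + 20 * kap.

Let lamp : 0 < lam. Proof. by apply: lt_le_trans l0; rewrite divr_gt0. Qed.
Let C10 : 0 <= C1. Proof. by rewrite addr_ge0 ?le_max ?lexx // ln_ge0 // ler1n. Qed.
Let W1 : 1000 <= 1000 * curve_cst xi. Proof. by rewrite ler_peMr ?ler0n // curve_cst_ge1. Qed.
Let W0 : 0 < 1000 * curve_cst xi. Proof. by apply: lt_le_trans W1; rewrite ltr0n. Qed.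
Let eW : 1000 * curve_cst xi = expR kap. Proof. by rewrite lnK. Qed.
Let kap0 : 0 <= kap. Proof. by rewrite ln_ge0 // (le_trans _ W1) // ler1n. Qed.
Let C0 : 0 <= C. Proof. by rewrite addr_ge0 // mulr_ge0. Qed.

Let e0 k : 0 < err (x k). Proof. exact: err_best_gt0. Qed.
Let X0 k : (0 : R) < (X k)%:R. Proof. by rewrite ltr0n den_gt0. Qed.

Lemma minpt_log k : lam * ln (X k.+1)%:R - C1 <= - ln (err (x k)).
Proof.
have X2 : 2 <= (X k.+1)%:R :> R.
  by rewrite ler_nat; apply: leq_ltn_trans (den_lt best_improves k); exact: den_gt0.
have XX : 1 <= (X k.+1)%:R / 2 :> R by lra.
have [p [pn hp ep]] := approx XX.
have hlt : height R p < (X k.+1)%:R by apply: le_lt_trans hp _; lra.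
have := le_trans (@minpt_minimal _ _ best_improves k p pn hlt) ep.
have P1 : 0 < (X k.+1)%:R / 2 :> R by lra.
have P2 : 0 < ((X k.+1)%:R / 2) `^ (- lam) by rewrite powR_gt0.
rewrite -ler_ln ?posrE ?e0 ?mulr_gt0 // lnM ?posrE // ln_powR ln_div ?posrE ?X0 ?ltr0n //.
have l2 : 0 <= ln (2 : R) by rewrite ln_ge0 // ler1n.
have l3 : lam * ln 2 <= 1 * ln (2 : R) by rewrite ler_wpM2r //; have := l1; lra.
have : ln c <= Num.max 0 (ln c) by rewrite le_max lexx orbT.
rewrite /C1; lra.
Qed.

Lemma ln_den_infty (M : R) : exists N, forall k, (N <= k)%N -> M <= ln (X k)%:R.
Proof.
exists (Num.bound (expR M)) => k Nk; rewrite -[M]expRK ler_ln ?posrE ?expR_gt0 ?X0 //.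
apply: ltW; apply: (lt_le_trans (archi_boundP (expR_ge0 M))).
by rewrite ler_nat (leq_trans Nk) // ltnW // den_ge.
Qed.

(** The error of [x k] is at most [X k.+1] to the power [- lam] up to a constant, and
    [lam > 2/3] makes [X k.+1 ^ 2] times the cube of that error tend to zero. *)
Lemma eventually_phi_neq0 : exists k0, forall k, (k0 <= k)%N -> phi (x k) != 0.
Proof.
have [N hN] := ln_den_infty (9 * (ln 8 + 3 * C1) + 1).
exists N.+1 => -[//|k] kN; have {}hN := hN k.+1 (leqW kN).
have lg := minpt_log k.
apply: (@phi_neq0 _ xi _ (x k) (err (x k))) => //.
- by rewrite !height_minpt ler_nat ltnW // den_lt.
- by rewrite ltW // err_minpt_lt.
- rewrite height_minpt -ltr_ln ?posrE ?mulr_gt0 ?exprn_gt0 ?X0 ?e0 ?ltr0n //.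
  rewrite ln1 lnM ?posrE ?mulr_gt0 ?exprn_gt0 ?X0 ?e0 ?ltr0n // lnM ?posrE ?exprn_gt0 ?X0 ?e0 //.
  rewrite !lnXn ?X0 ?e0 //.
  have : 19 / 27 * ln (X k.+1)%:R <= lam * ln (X k.+1)%:R.
    by rewrite ler_wpM2r // ln_ge0 // ler1n den_gt0.
  move: lg hN; move: (ln _) (lam * _) => u v; lra.
by have := minpt_minor best_improves k;
  rewrite ![pt0 (x k.+1) * _]mulrC.
Qed.

(** The indices [i s] run through the successive steps.  A link estimate at one step
    gives the smallness conditions at the next one, so that [stage_log] applies to all
    steps from some point on and [no_chain] concludes. *)
Lemma no_exponent : False.
Proof.
have [k0 hk0] := eventually_phi_neq0.
pose i s := iter s (next_stage best_improves indep) k0.+1.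
have iS s : i s.+1 = next_stage best_improves indep (i s) by [].
have ik s : (k0 < i s)%N.
  by elim: s => [//|s IH]; rewrite iS; apply: ltn_trans IH _; exact: next_stage_lt.
have is_ s : (s <= i s)%N.
  by elim: s => [//|s IH]; rewrite iS; apply: leq_ltn_trans IH _; exact: next_stage_lt.
pose a s : R := ln (X (i s))%:R.
pose b s : R := ln (X (i s).+1)%:R.
pose l s : R := - ln (err (x (i s))).
pose al s : R := ln `|(phi (x (i s)))%:~R|.
have hphi s : phi (x (i s)) != 0 by apply: hk0; exact: ltnW (ik s).
have lnX_le j k : (j <= k)%N -> ln (X j)%:R <= ln (X k)%:R :> R.
  by move=> jk; rewrite ler_ln ?posrE ?X0 // ler_nat den_mono.
have e1 k : err (x k) <= 1 by apply: le_trans (err_best_half _ _) _; lra.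
have h1 k : 1 <= height R (x k) by rewrite height_minpt ler1n den_gt0.
have eX k : height R (x k) = expR (ln (X k)%:R) by rewrite height_minpt lnK // posrE X0.
have eE k : err (x k) = expR (- (- ln (err (x k)))) by rewrite opprK lnK // posrE.
have eA s : `|(phi (x (i s)))%:~R : R| = expR (al s).
  by rewrite lnK // posrE normr_gt0 intr_eq0.
have al_le s : al s <= 2 * a s - l s + kap.
  rewrite -ler_expR -eA; apply: (le_trans (phi_le_pair (h1 _) (e1 _))).
  have -> : expR (2 * a s - l s + kap) = 1000 * curve_cst xi * (height R (x (i s)) ^+ 2 * err (x (i s))).
    by rewrite eW eX (eE (i s)) -expRM_natl -!expRD; congr expR; rewrite /l /a; ring.
  rewrite ler_wpM2r ?mulr_ge0 ?exprn_ge0 ?err_ge0 ?height_ge0 // ler_wpM2r ?ler_nat //.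
  exact: le_trans ler01 (curve_cst_ge1 xi).
have steps s := @stage_step _ _ best_improves indep (i s) (leq_ltn_trans (leq0n _) (ik s)).
have links s : link lam C (a s) (b s) (l s) (al s) (a s.+1) (b s.+1) (l s.+1) (al s.+1).
  have [n [m [_ _ index det]]] := steps s.
  split.
  - by rewrite ln_ge0 // ler1n den_gt0.
  - exact: lnX_le.
  - apply: lnX_le; rewrite iS; exact: next_stage_lt.
  - exact: lnX_le.
  - by have := minpt_log (i s); rewrite -/(b s) -/(l s) /C; have := kap0; lra.
  - by have := minpt_log (i s.+1); rewrite -/(b s.+1) -/(l s.+1) /C; have := kap0; lra.
  - have h : a s.+1 <= kap + (b s + (b s.+1 + (- l s - l s.+1))).
      rewrite -ler_expR; have -> : expR (a s.+1) = height R (x (i s.+1)) by rewrite -eX.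
      apply: (le_trans index).
      have -> : expR (kap + (b s + (b s.+1 + (- l s - l s.+1)))) =
        1000 * curve_cst xi * (height R (x (i s).+1) * (height R (x (i s.+1).+1) * (err (x (i s)) * err (x (i s.+1))))).
        by rewrite eW !eX (eE (i s)) (eE (i s.+1)) -!expRD.
      move: det; rewrite -iS; set D := height R _ * (_ * _) => det.
      have D0 : 0 <= D by rewrite /D !mulr_ge0 ?height_ge0 ?err_ge0.
      move: (height R (x (i s).+1)) (height_ge0 R (x (i s).+1)) => Q Q0.
      have h2 := ler_wpM2r Q0 det.
      have h3 := ler_wpM2r (mulr_ge0 Q0 D0) W1.
      have h4 := mulr_ge0 Q0 D0.
      move: h2 h3 h4; clear det D0; move: D (_ * curve_cst xi) (`|_|) => D' W M; lra.
    by rewrite /C; have := kap0; have := C10; lra.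
  - by rewrite ln_ge0 // norm_int_ge1.
  - by apply: (le_trans (al_le s)); rewrite lerD2l /C; have := kap0; have := C10; lra.
  - by rewrite ln_ge0 // norm_int_ge1.
  - by apply: (le_trans (al_le s.+1)); rewrite lerD2l /C; have := kap0; have := C10; lra.
have a_infty M : exists N, forall s, (N <= s)%N -> M <= a s.
  have [N hN] := ln_den_infty M; exists N => s Ns.
  by apply: hN; exact: leq_trans (is_ s).
apply: (no_chain l0 l1 erefl lmu C0 a_infty links).
have [N1 hN1] := a_infty 1; have [N2 hN2] := a_infty (4000 * C).
exists (maxn N1 N2).+1 => -[//|s]; rewrite ltnS geq_max => /andP[s1 s2].
have lk t := link_lam l0 (links t).
have p0 t : (N1 <= t)%N -> 0 < a t by move=> /hN1; apply: lt_le_trans.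
have hb := link_growth C0 (p0 _ s1) (hN2 _ s2) (lk s).
have [m1 m2 m3] := link_smallness C0 (p0 _ (leqW s1)) (hN2 _ (leqW s2)) (lk s.+1) hb.
have kC : 20 * kap <= C by rewrite lerDr.
have [n [m [comb cop index _]]] := steps s.+1.
rewrite -iS in comb index.
have lte := err_minpt_mono best_improves (next_stage_lt best_improves indep (i s.+1)).
have S : stage xi (x (i s.+1)) (x (i s.+1).+1) (x (i s.+2)) n m.
  split; [exact: comb|exact: cop|exact: h1| | |exact: index|exact: e0|exact: e1| |exact: e0| |exact: hphi|exact: hphi| | |].
  - by rewrite !height_minpt ler_nat ltnW // den_lt.
  - by rewrite !height_minpt ler_nat den_mono // next_stage_lt.
  - exact: err_minpt_lt.
  - by apply: (le_trans lte); rewrite ltW // err_minpt_lt.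
  - have h : 1000 * curve_cst xi * (height R (x (i s.+1)) ^+ 3 * err (x (i s.+2))) <= 1.
      have -> : 1000 * curve_cst xi * (height R (x (i s.+1)) ^+ 3 * err (x (i s.+2)))
          = expR (kap + (3 * a s.+1 - l s.+2)).
        by rewrite eW eX (eE (i s.+2)) -expRM_natl -!expRD.
      rewrite -[leRHS]expR0 ler_expR; exact: absorb_cst kap0 kC m1.
    apply: le_trans h; rewrite ler_wpM2r ?mulr_ge0 ?exprn_ge0 ?height_ge0 ?err_ge0 //.
    by rewrite ler_wpM2r ?ler_nat // (le_trans ler01) ?curve_cst_ge1.
  - have h : 1000 * curve_cst xi * (height R (x (i s.+1)) * err (x (i s.+1)) ^+ 2) <= 1.
      have -> : 1000 * curve_cst xi * (height R (x (i s.+1)) * err (x (i s.+1)) ^+ 2)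
          = expR (kap + (a s.+1 + 2 * - l s.+1)).
        by rewrite eW eX (eE (i s.+1)) -expRM_natl -!expRD.
      rewrite -[leRHS]expR0 ler_expR mulrN; exact: absorb_cst kap0 kC m2.
    apply: le_trans h; rewrite ler_wpM2r ?mulr_ge0 ?exprn_ge0 ?height_ge0 ?err_ge0 //.
    by rewrite ler_wpM2r ?ler_nat // (le_trans ler01) ?curve_cst_ge1.
  - set D := height R (x (i s.+1)) ^+ 3 * _ * _ * _.
    have D0 : 0 <= D by rewrite /D !mulr_ge0 ?exprn_ge0 ?height_ge0 ?err_ge0.
    have h : (1000 * curve_cst xi) ^+ 2 * D <= 1.
      have -> : (1000 * curve_cst xi) ^+ 2 * D
          = expR (2 * kap + (3 * a s.+1 + a s.+2 + - l s.+1 + - l s.+2)).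
        by rewrite eW /D !eX (eE (i s.+1)) (eE (i s.+2)) -!expRM_natl -!expRD.
      rewrite -[leRHS]expR0 ler_expR; exact: absorb_cst2 kap0 kC m3.
    apply: le_trans h; rewrite ler_wpM2r // exprMn ler_wpM2r ?sqr_ge0 //.
    by have := ler_nat R 400 (1000 ^ 2); rewrite natrX => ->.
have := @stage_log _ xi _ _ _ _ _ S kap (a s.+1) (b s.+1) (a s.+2) (l s.+1) (al s.+1) (al s.+2)
  eW (eX _) (eX _) (eX _) (eE _) (eA _) (eA _).
by case=> h; [left; exact: degenerate_le kC h|right; exact: generic_le kC h].
Qed.
End Main.

(** * The exponent of the point on the cubic *)

Lemma cube_indep (R : realType) (xi : R) : lin_indep_rat (point_cube xi) ->
  forall u0 u1 u2 : int, u0%:~R + u1%:~R * xi + u2%:~R * xi ^+ 3 = 0 ->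
  [/\ u0 = 0, u1 = 0 & u2 = 0].
Proof.
move=> h u0 u1 u2 e.
have hq := h (fun i : 'I_3 => [:: u0%:Q; u1%:Q; u2%:Q]`_i).
have s0 : \sum_(i < 3) ratr [:: u0%:Q; u1%:Q; u2%:Q]`_i * point_cube xi ord0 i = 0.
  by rewrite !big_ord_recl big_ord0 !mxE /= !ratr_int mulr1 addr0 addrA.
have {}hq := hq s0.
have /eqP := hq (inord 0); have /eqP := hq (inord 1); have /eqP := hq (inord 2).
by rewrite !inordK //= !intr_eq0 => /eqP -> /eqP -> /eqP ->.
Qed.

Lemma cube_approx (R : realType) (xi lam c X : R) (v : 'rV[int]_3) :
  v != 0 -> `|(v ord0 ord0)%:~R| <= X ->
  approx_error (point_cube xi) v <= c * X `^ (- lam) ->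
  exists p : zpoint, [/\ [|| pt0 p != 0, pt1 p != 0 | pt2 p != 0],
    height R p <= X & err xi p <= c * X `^ (- lam)].
Proof.
move=> v0 vX ve; exists (ZPoint (v ord0 ord0) (v ord0 (lift ord0 ord0)) (v ord0 (lift ord0 (lift ord0 ord0)))).
split=> //.
  apply: contraNT v0; rewrite !negb_or !negbK /= => /and3P[/eqP a0 /eqP a1 /eqP a2].
  apply/eqP/rowP => i; rewrite mxE.
  case: (unliftP ord0 i) => [j ->|->//].
  by case: (unliftP ord0 j) => [k ->|->//]; rewrite (ord1 k).
apply: le_trans ve; apply: err_le.
  apply: le_trans (le_bigmax _ _ (ord0 : 'I_2)); rewrite /= !mxE /= mulr1 distrC.
  by rewrite /dev1.
apply: le_trans (le_bigmax _ _ (lift ord0 ord0 : 'I_2)); rewrite /= !mxE /= mulr1 distrC.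
by rewrite /dev2.
Qed.

Theorem theorem1p2 (R : realType) (xi : R)
    (hxi : lin_indep_rat (point_cube xi)) :
  (lambda_hat (point_cube xi) <= (2 * (9 + Num.sqrt 11) / 35)%:E)%E.
Proof.
apply: ge_ereal_sup => _ [lam0 [_ [c c0 happ]] <-].
rewrite lee_fin leNgt; apply/negP => lt.
set s : R := Num.sqrt 11 in lt.
have s2 : s ^+ 2 = 11 by rewrite sqr_sqrtr // ler0n.
have s0 : 0 <= s by exact: sqrtr_ge0.
have [s3 s4] : 3316 / 1000 < s /\ s < 3317 / 1000 by split; nra.
(* The approximation property passes to smaller exponents; [704/1000] is
   slightly above the bound. *)
pose lam := Num.min lam0 (704 / 1000).
have mlam : 2 * (9 + s) / 35 < lam by rewrite /lam lt_min lt /=; lra.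
apply: (@no_exponent R xi lam c) => //.
- lra.
- by rewrite /lam ge_min lexx orbT.
- nra.
- exact: cube_indep.
move=> X X1; have [v [v0 vX ve]] := happ X X1.
apply: (@cube_approx R xi lam c X v v0 vX); apply: (le_trans ve).
rewrite ler_wpM2l ?(ltW c0) // ler_powR // lerN2.
by rewrite /lam ge_min lexx.
Qed.
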